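(* Let $X\neq L^\infty$ be any rearrangement invariant (r.i.) space on $[0,1]$. (a) The space $L^1(m_X)$ is not reflexive. Hence, the Cesàro space $[\mathcal{C},X]$ is not reflexive either. (b) The Cesàro space $[\mathcal{C},X]$ is not r.i. Moreover, neither is $L^1(m_X)=[\mathcal{C},X]_a$.
   Context: $\lambda$ is Lebesgue measure on $[0,1]$, $\mathcal{M}$ the $\sigma$-algebra of Lebesgue measurable subsets of $[0,1]$, $f^*$ the decreasing rearrangement of a measurable function $f$ on $[0,1]$ (right-continuous inverse of $\tau\mapsto\lambda(\{|f|>\tau\})$). Functions are real-valued. A Banach function space (B.f.s.) $X$ on $[0,1]$ is a Banach space of ($\lambda$-a.e. classes of) measurable functions on $[0,1]$ such that $g\in X$ and $\|g\|_X\le\|f\|_X$ whenever $f\in X$ and $|g|\le|f|$ a.e. A r.i. space is a B.f.s. on $[0,1]$ such that if $g^*\le f^*$ and $f\in X$ then $g\in X$ and $\|g\|_X\le\|f\|_X$. Every r.i. space satisfies $L^\infty\subseteq X\subseteq L^1$. The Fatou property is not assumed. The absolutely continuous part $Y_a$ of a B.f.s. $Y$ is the space of all $f\in Y$ with $\lim_{\lambda(A)\to0}\|f\chi_A\|_Y=0$. The Cesàro operator is $\mathcal{C}(f)(x):=\frac1x\int_0^x f(t)\,dt$. The Cesàro space is the B.f.s. $[\mathcal{C},X]:=\{f:\mathcal{C}(|f|)\in X\}$ with norm $\|f\|_{[\mathcal{C},X]}:=\|\mathcal{C}(|f|)\|_X$. The set function $m_X\colon\mathcal{M}\to X$, $m_X(A):=\mathcal{C}(\chi_A)$,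 is a $\sigma$-additive vector measure with the same null sets as $\lambda$. For a vector measure $m\colon\mathcal{M}\to X$ and $x^*\in X^*$ let $x^*m(A)=\langle m(A),x^*\rangle$, with variation $|x^*m|$. A measurable $f$ is $m$-integrable if $f\in L^1(|x^*m|)$ for all $x^*\in X^*$ and for each $A\in\mathcal{M}$ there is $\int_A f\,dm\in X$ with $\langle\int_A f\,dm,x^*\rangle=\int_A f\,d(x^*m)$ for all $x^*\in X^*$. $L^1(m)$ is the Banach space of (classes modulo $m$-null sets of) $m$-integrable functions with norm $\|f\|_{L^1(m)}=\sup_{\|x^*\|\le1}\int|f|\,d|x^*m|$. It is known that $L^1(m_X)=[\mathcal{C},X]_a$ with equal norms. *)

(* Defs.v *)
From HB Require Import structures.
From mathcomp Require Import all_boot all_order all_algebra.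
From mathcomp Require Import all_classical all_reals all_analysis.
From mathcomp Require Import ess_sup_inf.

Set Implicit Arguments.
Unset Strict Implicit.
Unset Printing Implicit Defensive.
Import Order.TTheory GRing.Theory Num.Theory.
Import numFieldNormedType.Exports.

Local Open Scope classical_set_scope.
Local Open Scope ring_scope.

(* A normed space is given by a linear subspace [carrier] of an ambient vector
   space E together with a (semi)norm on it.  Vectors at distance 0 are not
   identified: this is how spaces of classes of a.e. equal functions are
   handled, with functions as representatives.  [sp_norm] is irrelevant
   outside [carrier]. *)
Record nspace (R : realType) (E : lmodType R) := NSpace {
  carrier :> E -> Prop ;
  sp_norm : E -> R }.

Section duality.
Context {R : realType}.

(* A functional on Y is represented by a map on E of which only the values on Y
   matter: two maps that agree on Y are at distance 0 in [dual Y]. *)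
Definition linear_on (E : lmodType R) (Y : nspace E) (phi : E -> R) : Prop :=
  forall (a : R) (f g : E), Y f -> Y g -> phi (a *: f + g) = a * phi f + phi g.

Definition dual (E : lmodType R) (Y : nspace E) : nspace (E -> R) :=
  NSpace
    [set phi | linear_on Y phi /\
       exists C : R, forall f, Y f -> `|phi f| <= C * sp_norm Y f]
    (fun phi => sup [set `|phi f| | f in [set f | Y f /\ sp_norm Y f <= 1]]).

(* The canonical embedding of Y into its bidual is onto.  (Elements of
   [dual (dual Y)] are bounded, so they cannot separate maps that agree on Y.) *)
Definition reflexive_space (E : lmodType R) (Y : nspace E) : Prop :=
  forall Phi, dual (dual Y) Phi ->
    exists2 f, Y f & forall phi, dual Y phi -> Phi phi = phi f.

End duality.

(* The real line with the sigma-algebra of Lebesgue measurable sets. *)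
Notation Leb R := (caratheodory_type (@wlength R idfun)^*%mu).
Notation lambda := completed_lebesgue_measure.

Section function_spaces.
Context {R : realType}.

(* A function on [0,1] is represented by a function on the real line whose
   values outside [0,1] are irrelevant. *)
Definition I01 : set (Leb R) := `[0%R, 1%R]%classic.

Notation fspace := (nspace (Leb R -> R)).

Definition banach_function_space (X : fspace) : Prop :=
  [/\ (forall f, X f -> measurable_fun I01 f),
      X 0 /\ (forall (a : R) f g, X f -> X g -> X (a *: f + g)),
      [/\ (forall f, X f -> 0 <= sp_norm X f),
          (forall f, X f ->
             (sp_norm X f = 0 <-> {ae lambda, forall x, I01 x -> f x = 0})),
          (forall (a : R) f, X f -> sp_norm X (a *: f) = `|a| * sp_norm X f) &
          (forall f g, X f -> X g ->
             sp_norm X (f + g) <= sp_norm X f + sp_norm X g)],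
      (forall f g : Leb R -> R, X f -> measurable_fun I01 g ->
         {ae lambda, forall x, I01 x -> `|g x| <= `|f x|} ->
         X g /\ sp_norm X g <= sp_norm X f) &
      (forall u : nat -> (Leb R -> R), (forall n, X (u n)) ->
         (forall e : R, 0 < e -> exists N, forall m n, (N <= m)%N -> (N <= n)%N ->
            sp_norm X (u m - u n) < e) ->
         exists2 f, X f & (fun n => sp_norm X (u n - f)) @ \oo --> (0 : R))].

Definition distribution (f : Leb R -> R) (tau : R) : \bar R :=
  lambda (I01 `&` [set x | tau < `|f x|]).

(* f^*(t); the value +oo can only occur at t = 0. *)
Definition rearrangement (f : Leb R -> R) (t : R) : \bar R :=
  ereal_inf [set tau%:E | tau in
    [set tau : R | 0 <= tau /\ (distribution f tau <= t%:E)%E]].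

Definition rearrangement_invariant (X : fspace) : Prop :=
  forall f g : Leb R -> R, X f -> measurable_fun I01 g ->
    (forall t : R, 0 <= t <= 1 -> (rearrangement g t <= rearrangement f t)%E) ->
    X g /\ sp_norm X g <= sp_norm X f.

(* The zero space is excluded, as it does not contain L^oo. *)
Definition ri_space (X : fspace) : Prop :=
  [/\ banach_function_space X,
      rearrangement_invariant X &
      exists2 f, X f & ~ {ae lambda, forall x, I01 x -> f x = 0}].

Definition Linfty : set (Leb R -> R) :=
  [set f : Leb R -> R | measurable_fun I01 f /\
           (ess_sup lambda (abse \o ((EFin \o f) \_ I01)) < +oo)%E].

Definition ac_part (Y : fspace) : fspace :=
  NSpace
    [set f : Leb R -> R | Y f /\ forall e : R, 0 < e -> exists2 d : R, 0 < d &
       forall A : set (Leb R), measurable A -> A `<=` I01 ->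
         (lambda A < d%:E)%E -> sp_norm Y (fun x => f x * \1_A x) < e]
    (sp_norm Y).

Definition cesaro (f : Leb R -> R) : Leb R -> R :=
  fun x => (x : R)^-1 * \int[lambda]_(t in (`[0%R, x : R]%classic : set (Leb R))) f t.

(* [Rintegral] takes the value 0 at functions with infinite integral, so that
   the finiteness of C(|f|) a.e. has to be required separately. *)
Definition cesaro_space (X : fspace) : fspace :=
  NSpace
    [set f : Leb R -> R | [/\ measurable_fun I01 f,
       {ae lambda, forall x, I01 x ->
          lambda.-integrable (`[0%R, x : R]%classic : set (Leb R)) (EFin \o f)} &
       X (cesaro (fun x => `|f x|))]]
    (fun f => sp_norm X (cesaro (fun x => `|f x|))).

End function_spaces.

Notation fspace R := (nspace (Leb R -> R)).

Section vector_measures.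
Context {R : realType}.

Definition variation (nu : set (Leb R) -> R) (A : set (Leb R)) : \bar R :=
  ereal_sup [set s | exists n (F : nat -> set (Leb R)),
    [/\ forall i, measurable (F i), trivIset `I_n F,
        \big[setU/set0]_(i < n) F i = A &
        s = (\sum_(i < n) `|nu (F i)|)%:E]].

(* Integration with respect to a signed measure by means of its Jordan
   decomposition into (|nu| + nu)/2 and (|nu| - nu)/2. *)
Definition signed_integral (nu : set (Leb R) -> R) (A : set (Leb R))
    (f : Leb R -> R) : R :=
  let nu_pos := (fun B => (2^-1)%:E * (variation nu B + (nu B)%:E))%E in
  let nu_neg := (fun B => (2^-1)%:E * (variation nu B - (nu B)%:E))%E in
  fine (\int[nu_pos]_(x in A) (f x)%:E)%E
  - fine (\int[nu_neg]_(x in A) (f x)%:E)%E.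

Definition vm_integrable (X : fspace R) (m : set (Leb R) -> Leb R -> R)
    (f : Leb R -> R) : Prop :=
  [/\ measurable_fun I01 f,
      (forall phi, dual X phi ->
         (variation (phi \o m)).-integrable I01 (EFin \o f)) &
      (forall A : set (Leb R), measurable A -> A `<=` I01 ->
         exists2 h : Leb R -> R, X h & forall phi, dual X phi ->
           phi h = signed_integral (phi \o m) A f)].

Definition L1_vm (X : fspace R) (m : set (Leb R) -> Leb R -> R) : fspace R :=
  NSpace
    [set f | vm_integrable X m f]
    (fun f => fine (ereal_sup
       [set (\int[variation (phi \o m)]_(x in I01) `|f x|%:E)%E |
          phi in [set phi | dual X phi /\ sp_norm (dual X) phi <= 1]])).

Definition cesaro_measure (A : set (Leb R)) : Leb R -> R := cesaro \1_A.

End vector_measures.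

(* Main.v *)
Require Import Defs.
From HB Require Import structures.
From mathcomp Require Import all_boot all_order all_algebra.
From mathcomp Require Import all_classical all_reals all_analysis.
From mathcomp Require Import finmap measurable_realfun ring lra.

Set Implicit Arguments.
Unset Strict Implicit.
Unset Printing Implicit Defensive.
Import Order.TTheory GRing.Theory Num.Theory.
Import numFieldNormedType.Exports.

Local Open Scope classical_set_scope.
Local Open Scope ring_scope.

(** All the spaces involved look like [L^1] on [J = ]1/2, 3/4]]: for [S] inside
    [J], [C 1_S] is at most [2 lambda(S)] and equals [lambda(S) / x] on
    []3/4, 1]].

    Non-reflexivity: the normalised indicators of []1/2, 1/2 + 1/(4(n+1))]] are
    bounded, and a weak* cluster point of them in the bidual is not a function,
    since integration over []1/2 + t, 3/4]], a bounded functional, does not see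
    it for [t > 0] whereas integration over [J] does.

    Failure of rearrangement invariance: [C] maps [A = ]1/2, 1]] to a function at
    most [1/2], while [C 1_B] for the equimeasurable [B = ]0, 1/2]] is at least
    [1] on [B] and [1/2] on [A], so that by rearrangement invariance of [X] its
    norm is at least 3/4 of the norm of the constant [1].

    For [L^1(m)], functionals on [X] come from the Hahn-Banach theorem, and the
    supremum that defines the norm is finite because countably many functionals
    of the unit ball are dominated, up to factors [2^k], by one positive
    functional. *)

(** * Seminormed spaces and reflexivity *)

(** The endpoints of J are chosen for two opposite estimates. Since J stays to the right of 1/2, the
    factor 1/x in C is below 2 wherever C 1_S is nonzero; since J stays to the left of 3/4, the
    interval ]3/4, 1] remains, on which C|f| is at least the integral of |f| over J because 1/x >=
    1. Hence scaled indicators of subsets of J have norm at most a multiple of their L^1 norm, while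
    integration over J is bounded on the whole space.

    In [L1_vm] the norm is a supremum of integrals against variations, so the second estimate calls
    for one functional whose composition with m is a multiple of lambda on J. Restriction to ]3/4,
    1] provides it: there all m(S) with S inside J are multiples of a single function u, and a
    functional norming u does the job.

    For the failure of invariance, the pointwise bound C 1_B >= 1/2 would give only half the norm of
    1, which is no more than the upper bound for C 1_A. Averaging a minorant of C 1_B with its
    mirror image raises the factor to 3/4 and so opens a gap. *)

Lemma ultra_fmap (S T : Type) (f : S -> T) (U : set_system S) :
  UltraFilter U -> UltraFilter (f @ U).
Proof.
move=> UU; have PU : ProperFilter U by exact: ultra_proper.
split=> [|G PG UG]; first exact: fmap_proper_filter.
apply/seteqP; split=> // A GA.
have [//|UA] := in_ultra_setVsetC (f @^-1` A) UU.
have GC : G (~` A) by exact: UG.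
by have /filter_ex[x []] : G (A `&` ~` A) by exact: filterI.
Qed.

Section seminormed_spaces.
Context {R : realType} {E : lmodType R}.
Implicit Types (Y : nspace E) (phi : E -> R).

Definition seminormed Y : Prop :=
  [/\ Y 0, forall a f g, Y f -> Y g -> Y (a *: f + g),
      forall f, Y f -> 0 <= sp_norm Y f,
      forall a f, Y f -> sp_norm Y (a *: f) = `|a| * sp_norm Y f &
      forall f g, Y f -> Y g -> sp_norm Y (f + g) <= sp_norm Y f + sp_norm Y g].

Lemma seminormedZ Y a f : seminormed Y -> Y f -> Y (a *: f).
Proof. by case=> Y0 Ycomb _ _ _ Yf; rewrite -[_ *: _]addr0; exact: Ycomb. Qed.

Lemma seminormedD Y f g : seminormed Y -> Y f -> Y g -> Y (f + g).
Proof. by case=> Y0 Ycomb _ _ _ Yf Yg; rewrite -[f]scale1r; exact: Ycomb. Qed.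

Lemma seminormed0 Y : seminormed Y -> sp_norm Y 0 = 0.
Proof.
by case=> Y0 _ _ normZ _; rewrite -(scale0r 0) normZ// normr0 mul0r.
Qed.

Lemma linear_on0 Y phi : Y 0 -> linear_on Y phi -> phi 0 = 0.
Proof.
move=> Y0 lphi; have := lphi 1 0 0 Y0 Y0.
rewrite scale1r addr0 mul1r => h; apply: (addrI (phi 0)).
by rewrite addr0 -h.
Qed.

Lemma linear_onZ Y phi a f : Y 0 -> linear_on Y phi -> Y f ->
  phi (a *: f) = a * phi f.
Proof.
by move=> Y0 lphi Yf; rewrite -[_ *: _]addr0 lphi// (linear_on0 Y0)// addr0.
Qed.

Lemma linear_onD Y phi f g : linear_on Y phi -> Y f -> Y g ->
  phi (f + g) = phi f + phi g.
Proof. by move=> lphi Yf Yg; rewrite -{1}[f]scale1r lphi// mul1r. Qed.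

Lemma dual_norm_ge Y phi f : (forall g, Y g -> 0 <= sp_norm Y g) ->
  dual Y phi -> Y f -> sp_norm Y f <= 1 -> `|phi f| <= sp_norm (dual Y) phi.
Proof.
move=> norm_ge0 [_ [C hC]] Yf f1; apply: sup_ubound; last by exists f.
(* [C] may be negative, and the norm of [g] is only known to be at most 1; the absolute value covers
   this. *)
exists `|C| => _ [g [Yg g1] <-].
rewrite (le_trans (hC _ Yg))// (le_trans (ler_norm _))// normrM.
by rewrite ler_piMr// ger0_norm// norm_ge0.
Qed.

Lemma dual_norm_le Y phi C : Y 0 -> sp_norm Y 0 = 0 ->
  (forall f, Y f -> sp_norm Y f <= 1 -> `|phi f| <= C) ->
  sp_norm (dual Y) phi <= C.
Proof.
move=> Y0 n0 h; apply: ge_sup; first by exists `|phi 0|, 0 => //=; rewrite n0.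
by move=> _ [f [Yf f1] <-]; exact: h.
Qed.

Lemma dual_ball Y phi f : seminormed Y -> dual Y phi ->
  sp_norm (dual Y) phi <= 1 -> Y f -> `|phi f| <= sp_norm Y f.
Proof.
move=> sY dphi phi1 Yf; have [Y0 _ norm_ge0 normZ _] := sY.
have [lphi [C hC]] := dphi.
(* A vector of norm 0 cannot be normalised; there boundedness with any constant gives the claim. *)
have [f0|f0] := eqVneq (sp_norm Y f) 0.
  by have := hC _ Yf; rewrite f0 mulr0.
have fp : 0 < sp_norm Y f by rewrite lt0r f0 norm_ge0.
have Yg : Y ((sp_norm Y f)^-1 *: f) by exact: seminormedZ.
have := dual_norm_ge norm_ge0 dphi Yg.
rewrite normZ// (linear_onZ _ Y0 lphi Yf) normrM gtr0_norm ?invr_gt0// mulVf//.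
move=> /(_ (lexx _)) h.
by have := le_trans h phi1; rewrite ler_pdivrMl// mulr1.
Qed.

(* A weak* cluster point of [f] in the bidual: the functionals [psi k] see only
   finitely many of the [f n], so their limit [psi] would vanish on a
   representing element, whereas it is [c] along the sequence. *)
Lemma not_reflexive Y (f : nat -> E) (psi : nat -> E -> R) (psioo : E ->
  R) (c : R) :
  (forall g, Y g -> 0 <= sp_norm Y g) ->
  (forall n, Y (f n)) -> (forall n, sp_norm Y (f n) <= 1) ->
  (forall k, dual Y (psi k)) -> dual Y psioo ->
  (forall k n, (k <= n)%N -> psi k (f n) = 0) ->
  c != 0 -> (forall n, psioo (f n) = c) ->
  (forall g, Y g -> psi ^~ g @ \oo --> psioo g) ->
  ~ reflexive_space Y.
Proof.
move=> norm_ge0 Yf f1 dpsi dpsioo psi0 c0 psic cvpsi refl.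
(* An ultrafilter finer than [\oo] makes all the bounded sequences [phi (f n)] converge
   simultaneously, so that the limit is linear in [phi]. *)
have [U [UU ooU]] := @ultraFilterLemma nat \oo _.
have PU : ProperFilter U by exact: ultra_proper.
pose Phi (phi : E -> R) : R := lim (phi (f n) @[n --> U]).
have cvPhi phi : dual Y phi ->
    phi (f n) @[n --> U] --> Phi phi /\ `|Phi phi| <= sp_norm (dual Y) phi.
  move=> dphi; set M := sp_norm (dual Y) phi.
  have bnd n : phi (f n) \in `[- M, M].
    by rewrite in_itv/= -ler_norml dual_norm_ge.
  have cpt : compact [set` `[- M, M]] by exact: segment_compact.
  have UV : UltraFilter (phi (f n) @[n --> U]).
    exact: ultra_fmap.
  have [] : [set` `[- M, M]] `&` [set p | phi (f n) @[n --> U] --> p] !=set0.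
    move: cpt; rewrite compact_ultra; apply => //.
    by apply: (@filterS _ U _ setT) => [n _|]; [exact: bnd|exact: filterT].
  move=> l [lM cvl].
  have El : Phi phi = l by exact: cvg_lim.
  by rewrite El; split=> //; rewrite ler_norml; move: lM; rewrite /= in_itv.
have [|g Yg hg] := refl Phi.
  split; last by exists 1 => phi dphi; rewrite mul1r; exact: (cvPhi _ dphi).2.
  move=> a phi phi' dphi dphi'; apply: cvg_lim => //.
  apply: cvgD; last exact: (cvPhi _ dphi').1.
  by apply: cvgMr; exact: (cvPhi _ dphi).1.
have Epsi k : psi k g = 0.
  rewrite -hg//; apply: cvg_lim => //; apply: cvg_near_cst.
  by apply: ooU; exists k => // n /= kn; exact: psi0.
have Eoo : psioo g = c.
  rewrite -hg//; apply: cvg_lim => //; apply: cvg_near_cst.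
  by apply: nearW => n; exact: psic.
move: (cvpsi g Yg); under eq_cvg do rewrite Epsi.
move=> /(cvg_lim (@Rhausdorff _)); rewrite lim_cst// Eoo => /eqP.
by rewrite eq_sym (negbTE c0).
Qed.

End seminormed_spaces.

(** * The Hahn-Banach theorem *)

Section hahn_banach.
Context {R : realType} {E : lmodType R} (Y : nspace E).
Hypothesis sY : seminormed Y.
Implicit Types (G : set (E * R)) (f g u : E).

(* Functionals on subspaces of [Y] are represented by their graphs. *)
Definition dominated_graph G : Prop :=
  [/\ forall f r, G (f, r) -> Y f /\ r <= sp_norm Y f &
      forall a f r g s, G (f, r) -> G (g, s) -> G (a *: f + g, a * r + s)].

(** Subtracting the two pairs in either order puts [(0, r - s)] and [(0, s - r)] into [G], and the
    norm of 0 bounds both values from above. *)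
Lemma dominated_graph_fun G f r s :
  dominated_graph G -> G (f, r) -> G (f, s) -> r = s.
Proof.
move=> [Gdom Glin] Gr Gs.
have le0 p q : G (f, p) -> G (f, q) -> p <= q.
  move=> Gp Gq; have := Glin (-1) _ _ _ _ Gq Gp.
  rewrite scaleN1r addNr => /Gdom[_]; rewrite seminormed0//; lra.
by apply/eqP; rewrite eq_le !le0.
Qed.

(** The value [c] at [u] must lie above every [r - sp_norm Y (f - u)] and below every
    [sp_norm Y (g + u) - s]. The triangle inequality for f + g = (f - u) + (g + u) puts the first
    family below the second, so the supremum of the first is admissible. *)
Lemma dominated_graph_extend G u : dominated_graph G -> G !=set0 -> Y u ->
  exists c, dominated_graph
    [set x | exists a f r, G (f, r) /\ x = (a *: u + f, a * c + r)].
Proof.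
move=> [Gdom Glin] [[f0 r0] G0] Yu.
have [_ _ norm_ge0 normZ normD] := sY.
pose L := [set x | exists f r, G (f, r) /\ x = r - sp_norm Y (f - u)].
have subY f : Y f -> Y (f - u).
  by move=> Yf; apply: seminormedD => //; rewrite -scaleN1r; exact: seminormedZ.
have ubL g s : G (g, s) -> ubound L (sp_norm Y (g + u) - s).
  move=> Gg _ [f [r [Gf ->]]].
  have [Yf _] := Gdom _ _ Gf; have [Yg _] := Gdom _ _ Gg.
  have := Glin 1 _ _ _ _ Gf Gg; rewrite scale1r mul1r => /Gdom[_ h].
  have := normD _ _ (subY _ Yf) (seminormedD sY Yg Yu).
  rewrite (_ : f - u + (g + u) = f + g); last by rewrite addrACA addNr addr0.
  lra.
have L0 : L !=set0 by exists (r0 - sp_norm Y (f0 - u)), f0, r0.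
pose c := sup L.
have cge f r : G (f, r) -> r - sp_norm Y (f - u) <= c.
  move=> Gf; apply: ub_le_sup; last by exists f, r.
  by exists (sp_norm Y (f0 + u) - r0); exact: ubL.
have cle f r : G (f, r) -> c <= sp_norm Y (f + u) - r.
  by move=> Gf; apply: ge_sup => //; exact: ubL.
have G00 : G (0, 0).
  by have := Glin (-1) _ _ _ _ G0 G0; rewrite scaleN1r mulN1r !addNr.
have GZ a f r : G (f, r) -> G (a *: f, a * r).
  by move=> Gf; have := Glin a _ _ _ _ Gf G00; rewrite !addr0.
exists c; split.
  move=> _ s [a [f [r [Gf [-> ->]]]]]; have [Yf rf] := Gdom _ _ Gf.
  have Yauf : Y (a *: u + f) by apply: seminormedD => //; exact: seminormedZ.
  (* Dividing by the absolute value of [a] reduces to the coefficients -1 and 1 of [u], which are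
     the bounds [cge] and [cle]. *)
  split=> //; have [a0|a0|->] := ltgtP a 0.
  - have := cge _ _ (GZ (- a^-1) _ _ Gf).
    have -> : - a^-1 *: f - u = - a^-1 *: (a *: u + f).
      by rewrite scalerDr scalerA mulNr mulVf ?lt_eqF// scaleN1r addrC.
    rewrite normZ// gtr0_norm ?oppr_gt0 ?invr_lt0// -mulrBr -invrN mulrC.
    by rewrite ler_pdivrMr ?oppr_gt0//; lra.
  - have := cle _ _ (GZ a^-1 _ _ Gf).
    have -> : a^-1 *: f + u = a^-1 *: (a *: u + f).
      by rewrite scalerDr scalerA mulVf ?gt_eqF// scale1r addrC.
    rewrite normZ// gtr0_norm ?invr_gt0// -mulrBr.
    by rewrite mulrC ler_pdivlMr// mulrC; lra.
  - by rewrite scale0r add0r mul0r add0r.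
move=> b _ _ _ _ [a [f [r [Gf [-> ->]]]]] [a' [f' [r' [Gf' [-> ->]]]]].
exists (b * a + a'), (b *: f + f'), (b * r + r'); split; first exact: Glin.
congr pair; last by ring.
by rewrite scalerDr scalerDl scalerA addrACA.
Qed.

(** The functional a u -> a |u| on the line through [u] extends to a maximal dominated graph, and
    the one-step extension forces the domain of that graph to be all of [Y]. *)
Lemma hahn_banach u : Y u -> exists phi : E -> R,
  [/\ dual Y phi, sp_norm (dual Y) phi <= 1 & phi u = sp_norm Y u].
Proof.
move=> Yu; have [Y0 _ norm_ge0 normZ normD] := sY.
pose G0 : set (E * R) := [set x | exists a, x = (a *: u, a * sp_norm Y u)].
have G0dom : dominated_graph G0.
  split=> [_ _ [a [-> ->]]|b _ _ _ _ [a [-> ->]] [a' [-> ->]]].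
    split; first exact: seminormedZ.
    by rewrite normZ// ler_wpM2r ?norm_ge0// ler_norm.
  by exists (b * a + a'); rewrite !scalerDl !mulrDl scalerA mulrA.
pose P G := G = set0 \/ [/\ dominated_graph G & G0 `<=` G].
have [F FP totF|A [PA maxA]] := @Zorn_bigcup _ P.
  have [[B FB]|noB] := pselect (exists2 B, F B & B <> set0); last first.
    left; rewrite -subset0 => x [B FB Bx]; exfalso; apply: noB.
    by exists B => //; apply/eqP/set0P; exists x.
  move=> B0; right.
  have domF C : F C -> C !=set0 -> dominated_graph C.
    by move=> FC /set0P/eqP C0; have [|[]] := FP _ FC.
  split; last first.
    have [//|[_ G0B]] := FP _ FB.
    by move=> x /G0B Bx; exists B.
  split=> [f r [C FC Cf]|a f r g s [C FC Cf] [D FD Dg]].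
    have [h _] : dominated_graph C by apply: domF => //; exists (f, r).
    exact: h.
  have [CD|DC] := totF _ _ FC FD.
    have [_ h] : dominated_graph D by apply: domF => //; exists (g, s).
    by exists D => //; apply: h => //; exact: CD.
  have [_ h] : dominated_graph C by apply: domF => //; exists (f, r).
  by exists C => //; apply: h => //; exact: DC.
have G00 : G0 (0, 0) by exists 0; rewrite scale0r mul0r.
have [A0|[Adom G0A]] := PA.
  exfalso; apply: (maxA G0); last by right; split.
  by rewrite A0; split; [exact: sub0set|move=> /(_ _ G00)].
have Atot f : Y f -> exists r, A (f, r).
  move=> Yf; apply: contrapT => nAf.
  have [|c cdom] := dominated_graph_extend Adom _ Yf.
    by exists (0, 0); exact: G0A.
  have AB : A `<=` [set x | exists a f' r, A (f', r) /\ x = (a *: f + f',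
    a * c + r)].
    by move=> [g r] Ag; exists 0, g, r; split=> //; rewrite scale0r mul0r !add0r.
  apply: (maxA _ _); last by right; split; [exact: cdom|exact: subset_trans AB].
  split=> // BA; apply: nAf; exists c; apply: BA.
  by exists 1, 0, 0; split; [exact: G0A|rewrite scale1r mul1r !addr0].
have [phi hphi] : {phi : E -> R & forall f, Y f -> A (f, phi f)}.
  apply: (@choice _ _ (fun f r => Y f -> A (f, r))) => f.
  have [Yf|nYf] := pselect (Y f); last by exists 0.
  by have [r Ar] := Atot f Yf; exists r.
have lphi : linear_on Y phi.
  move=> a f g Yf Yg; apply: (dominated_graph_fun Adom) (hphi _ _) _.
    by apply: seminormedD => //; exact: seminormedZ.
  by apply: Adom.2; exact: hphi.
have phile f : Y f -> `|phi f| <= sp_norm Y f.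
  move=> Yf; rewrite ler_norml (Adom.1 _ _ (hphi _ Yf)).2 andbT.
  have YNf : Y (- f) by rewrite -scaleN1r; exact: seminormedZ.
  have := (Adom.1 _ _ (hphi _ YNf)).2.
  rewrite -scaleN1r (linear_onZ _ Y0 lphi Yf) normZ// normrN1; lra.
exists phi; split.
- by split=> //; exists 1 => f Yf; rewrite mul1r phile.
- apply: dual_norm_le => //; first exact: seminormed0.
  by move=> f Yf; apply: le_trans; exact: phile.
- apply: (dominated_graph_fun Adom) (hphi _ Yu) _; apply: G0A.
  by exists 1; rewrite scale1r mul1r.
Qed.

End hahn_banach.

(** * Positive functionals on a Banach function space *)

Section function_space_facts.
Context {R : realType} (X : fspace R).
Hypothesis bX : banach_function_space X.
Implicit Types (f g h : Leb R -> R).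

Lemma bfs_seminormed : seminormed X.
Proof. by have [_ [X0 Xcomb] [n0 _ nZ nD] _ _] := bX; split. Qed.

Lemma bfs_measurable f : X f -> measurable_fun I01 f.
Proof. by have [h _ _ _ _] := bX; exact: h. Qed.

Lemma bfs_ideal f g : X f -> measurable_fun I01 g ->
  (forall x, I01 x -> `|g x| <= `|f x|) -> X g /\ sp_norm X g <= sp_norm X f.
Proof.
have [_ _ _ h _] := bX => Xf mg gf; apply: h => //.
by apply: aeW => x /= Ix; exact: gf.
Qed.

(** [g1] is [g] cut off at height [h1] in both directions. Where the cut is active, the remainder
    has size |g| - h1, which is at most [h2]. *)
Lemma bfs_truncation h1 h2 g : X h1 -> X h2 -> X g ->
  (forall x, 0 <= h1 x) -> (forall x, 0 <= h2 x) ->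
  (forall x, `|g x| <= h1 x + h2 x) ->
  exists g1 g2, [/\ X g1, X g2, forall x, `|g1 x| <= h1 x,
    forall x, `|g2 x| <= h2 x & g = g1 + g2].
Proof.
move=> Xh1 Xh2 Xg h10 h20 gh.
have mh1 := bfs_measurable Xh1; have mg := bfs_measurable Xg.
pose g1 : Leb R -> R := fun x => Num.max (- h1 x) (Num.min (g x) (h1 x)).
have g1E x : [\/ g1 x = - h1 x /\ g x <= - h1 x, g1 x = g x
  /\ - h1 x <= g x <= h1 x |
    g1 x = h1 x /\ h1 x <= g x].
  have := h10 x; rewrite /g1 => h1x.
  have [gh1|/ltW hg1] := leP (g x) (h1 x).
    have [hg1|/ltW gh2] := leP (- h1 x) (g x); first by apply: Or32;
      split=> //; apply/andP.
    by apply: Or31.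
  by apply: Or33; rewrite max_r//; lra.
have g1le x : `|g1 x| <= h1 x.
  by have := h10 x; rewrite ler_norml; case: (g1E x) => -[->]; lra.
have g2le x : `|g x - g1 x| <= h2 x.
  have := h10 x; have := h20 x; have := gh x.
  by rewrite !ler_norml => /andP[? ?]; case: (g1E x) => -[->]; lra.
have mg1 : measurable_fun I01 g1.
  apply: measurable_maxr; last exact: measurable_minr.
  exact: measurableT_comp.
exists g1, (fun x => g x - g1 x); split=> //.
- apply: (bfs_ideal Xh1 _ _).1 => // x _.
  by rewrite (ger0_norm (h10 x)).
- apply: (bfs_ideal Xh2 _ _).1 => [|x _]; first exact: measurable_funB.
  by rewrite (ger0_norm (h20 x)).
- by apply/funext => x /=; rewrite fctE/= addrC subrK.
Qed.

End function_space_facts.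

Section positive_majorant.
Context {R : realType} (X : fspace R).
Hypothesis bX : banach_function_space X.
Variable phi : nat -> (Leb R -> R) -> R.
Hypothesis dphi : forall k, dual X (phi k).
Hypothesis phi1 : forall k, sp_norm (dual X) (phi k) <= 1.
Implicit Types (f g h : Leb R -> R).

Let sX : seminormed X := bfs_seminormed bX.
Let X0 : X 0. Proof. by case: sX. Qed.

Let lphi k : linear_on X (phi k). Proof. by case: (dphi k). Qed.

Let w (k : nat) : R := 2^-1 ^+ k.+1.

Let w_ge0 k : 0 <= w k. Proof. by rewrite exprn_ge0// invr_ge0. Qed.

Let sum_w n : \sum_(k < n) w k <= 1.
Proof.
suff -> : \sum_(k < n) w k = 1 - 2^-1 ^+ n.
  by rewrite gerBl exprn_ge0// invr_ge0.
elim: n => [|n IH]; first by rewrite big_ord0 expr0 subrr.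
by rewrite big_ord_recr/= IH /w exprS; field.
Qed.

(* The Riesz decomposition property [bfs_truncation] makes the supremum of this
   set additive in [h >= 0]. *)
Let majorant_set h : set R := [set r | exists n (g : nat -> Leb R -> R),
  [/\ forall k, X (g k), forall k x, `|g k x| <= h x &
      r = \sum_(k < n) w k * phi k (g k)]].

(** For [h] nonnegative this is the sum over k of [w k] times |phi k|(h), where |phi k| is the
    modulus of [phi k] in the dual lattice; a single supremum replaces moduli and series. *)
Let q h : R := sup (majorant_set h).

Let mem0 h : (forall x, 0 <= h x) -> majorant_set h 0.
Proof.
move=> h0; exists 0%N, (fun=> 0); split=> //; last by rewrite big_ord0.
by move=> k x; rewrite normr0.
Qed.

Let mem_le h r : X h -> majorant_set h r -> r <= sp_norm X h.
Proof.
move=> Xh [n [g [Xg gh ->]]].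
have gn k : phi k (g k) <= sp_norm X h.
  rewrite (le_trans (ler_norm _))// (le_trans (dual_ball sX (dphi k) (phi1 k)
    (Xg k)))//.
  apply: (bfs_ideal bX Xh _ _).2; first exact: (bfs_measurable bX).
  by move=> x _; rewrite (le_trans (gh k x))// ler_norm.
apply: (@le_trans _ _ (\sum_(k < n) w k * sp_norm X h)).
  by apply: ler_sum => k _; exact: ler_wpM2l.
rewrite -mulr_suml ler_piMl//; first by have [_ _ + _ _] := sX; exact.
Qed.

Let hs h : X h -> (forall x, 0 <= h x) -> has_sup (majorant_set h).
Proof.
move=> Xh h0; split; first by exists 0; exact: mem0.
by exists (sp_norm X h) => r; exact: mem_le.
Qed.

Let q_ge h r : X h -> (forall x, 0 <= h x) -> majorant_set h r -> r <= q h.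
Proof. by move=> Xh h0 hr; apply: sup_ubound => //; case: (hs Xh h0). Qed.

Let q_le h c : (forall x, 0 <= h x) ->
  (forall r, majorant_set h r -> r <= c) -> q h <= c.
Proof. by move=> h0 hc; apply: ge_sup => //; exists 0; exact: mem0. Qed.

Let qD h1 h2 : X h1 -> X h2 -> (forall x, 0 <= h1 x) -> (forall x, 0 <= h2 x) ->
  q (h1 + h2) = q h1 + q h2.
Proof.
move=> Xh1 Xh2 h10 h20.
have h120 x : 0 <= (h1 + h2) x by rewrite fctE addr_ge0.
have Xh12 : X (h1 + h2) by exact: seminormedD.
apply/eqP; rewrite eq_le; apply/andP; split.
  apply: q_le => // _ [n [g [Xg gh ->]]].
  have /choice[g1 /choice[g2 hg]] : forall k, exists g1 g2, [/\ X g1, X g2,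
      forall x, `|g1 x| <= h1 x, forall x, `|g2 x| <= h2 x & g k = g1 + g2].
    by move=> k; apply: (bfs_truncation bX).
  have -> : \sum_(k < n) w k * phi k (g k) =
      \sum_(k < n) w k * phi k (g1 k) + \sum_(k < n) w k * phi k (g2 k).
    rewrite -big_split/=; apply: eq_bigr => k _; rewrite -mulrDr.
    by have [Xg1 Xg2 _ _ ->] := hg k; rewrite (linear_onD (lphi k)).
  apply: lerD; apply: q_ge => //.
    by exists n, g1; split=> // k; have [] := hg k.
  by exists n, g2; split=> // k; have [] := hg k.
rewrite -lerBrDr; apply: q_le => // r1 [n1 [g1 [Xg1 gh1 r1E]]].
rewrite lerBrDr addrC -lerBrDr; apply: q_le => // r2 [n2 [g2 [Xg2 gh2 r2E]]].
rewrite lerBrDr; apply: q_ge => //.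
(* The two finite families may have different lengths: both are padded with 0, on which every
   [phi k] vanishes, and then added termwise. *)
pose g k : Leb R -> R := (if (k < n1)%N then g1 k else 0) + (if (k < n2)%N then
  g2 k else 0).
have X1 k : X (if (k < n1)%N then g1 k else 0) by case: ifP.
have X2 k : X (if (k < n2)%N then g2 k else 0) by case: ifP.
exists (maxn n1 n2), g; split.
- by move=> k; exact: seminormedD.
- move=> k x; rewrite /g fctE (le_trans (ler_normD _ _))//.
  by apply: lerD; case: ifP => // _; rewrite normr0.
- have ext (n m : nat) (f : nat -> Leb R -> R) : (n <= m)%N ->
      \sum_(k < n) w k * phi k (f k) =
      \sum_(k < m) w k * phi k (if (k < n)%N then f k else 0).
    move=> nm; rewrite (big_ord_widen _ (fun k =>
      w k * phi k (f k)) nm) big_mkcond/=.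
    apply: eq_bigr => k _; case: ifP => // _.
    by rewrite (linear_on0 X0 (lphi k)) mulr0.
  rewrite r1E r2E (ext _ _ g1 (leq_maxl n1 n2)) (ext _ _ g2 (leq_maxr n1 n2)).
  rewrite addrC -big_split/=; apply: eq_bigr => k _.
  by rewrite -mulrDr (linear_onD (lphi k)).
Qed.

Let qZ_ge a h : 0 < a -> X h -> (forall x, 0 <= h x) -> a * q h <= q (a *: h).
Proof.
move=> a0 Xh h0.
rewrite mulrC -ler_pdivlMr//; apply: q_le => // _ [n [g [Xg gh ->]]].
rewrite ler_pdivlMr//; apply: q_ge; first exact: seminormedZ.
  by move=> x; rewrite fctE mulr_ge0// ltW.
exists n, (fun k => a *: g k); split.
- by move=> k; exact: seminormedZ.
- by move=> k x; rewrite !fctE normrM gtr0_norm// ler_pM2l.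
- rewrite mulr_suml; apply: eq_bigr => k _.
  by rewrite (linear_onZ _ X0 (lphi k))//; ring.
Qed.

Let qZ a h : 0 <= a -> X h -> (forall x, 0 <= h x) -> q (a *: h) = a * q h.
Proof.
rewrite le_eqVlt => /predU1P[<-|a0] Xh h0.
  rewrite scale0r mul0r; apply/eqP; rewrite eq_le; apply/andP; split.
    by apply: q_le => // r /(mem_le X0); rewrite seminormed0.
  by apply: q_ge => //; exact: mem0.
apply/eqP; rewrite eq_le qZ_ge// andbT.
have ah0 x : 0 <= (a *: h) x by rewrite fctE mulr_ge0// ltW.
have := @qZ_ge a^-1 _ _ (seminormedZ a sX Xh) ah0.
rewrite scalerA mulVf ?gt_eqF// scale1r invr_gt0 => /(_ a0).
by rewrite ler_pdivrMl.
Qed.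

Let q_ge_phi k h : X h -> (forall x, 0 <= h x) -> w k * `|phi k h| <= q h.
Proof.
move=> Xh h0; apply: q_ge => //.
pose s : R := Num.sg (phi k h).
exists k.+1, (fun j => if j == k then s *: h else 0); split.
- by move=> j; case: ifP => // _; exact: seminormedZ.
- move=> j x; case: ifP => [_|_]; last by rewrite normr0.
  rewrite fctE normrM (ger0_norm (h0 x)) ler_piMl// /s normr_sg.
  by case: eqP.
- rewrite big_ord_recr/= eqxx big1 ?add0r; last first.
    by move=> j _; rewrite ltn_eqF// (linear_on0 X0 (lphi j)) mulr0.
  by rewrite (linear_onZ _ X0 (lphi k))// normrEsg.
Qed.

Let pos f : Leb R -> R := fun x => Num.max (f x) 0.

Let pos_ge0 f x : 0 <= pos f x. Proof. by rewrite /pos le_max lexx orbT. Qed.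

Let posB f x : f x = pos f x - pos (- f) x.
Proof.
rewrite /pos !fctE; have [f0|/ltW f0] := leP (f x) 0.
  by rewrite max_l ?oppr_ge0// sub0r opprK.
by rewrite max_r ?subr0// oppr_le0.
Qed.

Let Xpos f : X f -> X (pos f) /\ sp_norm X (pos f) <= sp_norm X f.
Proof.
move=> Xf; apply: bfs_ideal => //.
  by apply: measurable_maxr => //; exact: (bfs_measurable bX).
by move=> x _; rewrite /pos; case: (leP (f x) 0) => _ //; rewrite normr0.
Qed.

Let XN f : X f -> X (- f).
Proof. by move=> Xf; rewrite -scaleN1r; exact: seminormedZ. Qed.

Let psi f : R := q (pos f) - q (pos (- f)).

(** The value does not depend on the decomposition of [f] into nonnegative parts: f = g - h means
    pos f + h = pos (- f) + g, and [q] is additive. Linearity of [psi] follows by choosing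
    convenient decompositions. *)
Let psiE f g h : X f -> X g -> X h ->
  (forall x, 0 <= g x) -> (forall x, 0 <= h x) -> f = g - h ->
  psi f = q g - q h.
Proof.
move=> Xf Xg Xh g0 h0 fE.
have Xp := (Xpos Xf).1; have Xn := (Xpos (XN Xf)).1.
have : q (pos f + h) = q (pos (- f) + g).
  congr q; apply/funext => x; rewrite !fctE /pos fE !fctE.
  by do 2?[case: ltP => ?]; lra.
by rewrite !qD// /psi; lra.
Qed.

Lemma positive_majorant : exists2 psi, dual X psi &
  forall h, X h -> (forall x, 0 <= h x) ->
  forall k, 2^-1 ^+ k.+1 * `|phi k h| <= psi h.
Proof.
exists psi; last first.
  move=> h Xh h0 k; rewrite (@psiE h h 0)//; last by rewrite subr0.
  by rewrite -(scale0r 0) qZ// mul0r subr0 q_ge_phi.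
split; last first.
  (* Both terms of [psi f] lie between 0 and the norm of [f], so their difference obeys the bound
     with constant 1. *)
  exists 1 => f Xf; rewrite mul1r /psi.
  have [Xp np] := Xpos Xf; have [Xn nn] := Xpos (XN Xf).
  have nN : sp_norm X (- f) = sp_norm X f.
    by have [_ _ _ nZ _] := sX; rewrite -scaleN1r nZ// normrN1 mul1r.
  have qn0 g : q (pos g) >= 0 \/ ~ X g.
    have [Xg|] := pselect (X g); [left|by right].
    by apply: q_ge; [exact: (Xpos Xg).1|by []|exact: mem0].
  have qle g : X g -> q (pos g) <= sp_norm X g.
    move=> Xg; apply: q_le => // r hr.
    by apply: le_trans (Xpos Xg).2; apply: mem_le => //; exact: (Xpos Xg).1.
  have := qle _ Xf; have := qle _ (XN Xf); rewrite nN.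
  have [|//] := qn0 f; have [|] := qn0 (- f) => [|/(_ (XN Xf))//].
  by rewrite ler_norml; lra.
move=> a f g Xf Xg.
have [Xpf _] := Xpos Xf; have [Xnf _] := Xpos (XN Xf).
have [Xpg _] := Xpos Xg; have [Xng _] := Xpos (XN Xg).
have Xafg : X (a *: f + g).
  by apply: seminormedD => //; exact: seminormedZ.
have comb_ge0 b u v x : 0 <= b -> 0 <= (b *: pos u + pos v) x.
  by move=> b0; rewrite !fctE addr_ge0// mulr_ge0.
have Xcomb b u v : X u -> X v -> X (b *: u + v).
  by move=> Xu Xv; apply: seminormedD => //; exact: seminormedZ.
have qcomb b u v : 0 <= b -> X (pos u) -> X (pos v) ->
    q (b *: pos u + pos v) = b * q (pos u) + q (pos v).
  move=> b0 Xu Xv; rewrite qD ?qZ//; first exact: seminormedZ.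
  by move=> x; rewrite fctE mulr_ge0.
(* For negative [a] the positive and negative parts of [f] exchange their roles, since [q] is
   homogeneous only for nonnegative factors. *)
have [a0|/ltW a0] := leP 0 a.
  rewrite (@psiE _ (a *: pos f + pos g) (a *: pos (- f) + pos (- g)))//;
    do ?[by move=> x; exact: comb_ge0|exact: Xcomb].
    by rewrite !qcomb// /psi; ring.
  apply/funext => x; rewrite !fctE {1}(posB f x) {1}(posB g x).
  by rewrite /GRing.scale/=; ring.
have Na0 : 0 <= - a by rewrite oppr_ge0.
rewrite (@psiE _ (- a *: pos (- f) + pos g) (- a *: pos f + pos (- g)))//;
    do ?[by move=> x; exact: comb_ge0|exact: Xcomb].
  by rewrite !qcomb// /psi; ring.
apply/funext => x; rewrite !fctE {1}(posB f x) {1}(posB g x).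
by rewrite /GRing.scale/=; ring.
Qed.

End positive_majorant.

(** * Integrals with respect to set functions *)

(* The variations and the Jordan parts of [phi \o m] are plain set functions:
   the following facts on integrals hold without countable additivity. *)
Section integral_set_function.
Local Open Scope ereal_scope.
Import HBNNSimple.
Context d (T : measurableType d) (R : realType).
Implicit Types (mu : set T -> \bar R) (f : T -> \bar R) (A B D : set T).

Lemma sintegral_range mu (h : T -> R) : mu set0 = 0 ->
  sintegral mu h = \sum_(x \in range h) x%:E * mu (h @^-1` [set x]).
Proof.
move=> mu0; rewrite /sintegral (fsbig_widen (range h) setT)//= => x [_ Nhx] /=.
by rewrite preimage10// mu0 mule0.
Qed.

(** The integral is a difference of two suprema over simple functions. For nonnegative [f] the
    second one ranges over simple functions below 0, and only the value 0 occurs. *)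
Lemma ge0_integral_set_functionE mu D f : mu set0 = 0 ->
  (forall A, measurable A -> 0 <= mu A) -> (forall x, D x -> 0 <= f x) ->
  \int[mu]_(x in D) f x =
  ereal_sup [set sintegral mu h | h in [set h : {nnsfun T >-> R} |
    forall x, (h x)%:E <= (f \_ D) x]].
Proof.
move=> mu0 mu_ge0 f0; rewrite /integral funeneg_restrict funepos_restrict.
have /eq_restrictP-> := ge0_funeposE f0.
have /eq_restrictP-> := ge0_funenegE f0.
rewrite erestrict0.
suff -> : ereal_sup [set sintegral mu h | h in [set h : {nnsfun T >-> R} |
    forall x, (h x)%:E <= cst 0 x]] = 0 by rewrite sube0.
have sint0 (h : {nnsfun T >-> R}) : (forall x, (h x)%:E <= 0) -> sintegral mu h = 0.
  move=> h0; rewrite sintegral_range// fsbig1// => _ [x _ <-].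
  suff -> : h x = 0%R by rewrite mul0e.
  by apply/eqP; rewrite eq_le fun_ge0 andbT -lee_fin h0.
apply/eqP; rewrite eq_le; apply/andP; split.
  by apply: ge_ereal_sup => _ [h /= h0 <-]; rewrite sint0.
apply: ereal_sup_ubound; exists (@nnsfun0 _ T R) => //.
exact: sint0.
Qed.

(** A nonnegative simple function below [f \_ D] vanishes off [D], so its level sets at nonzero
    values lie in [D]; comparing the set functions on subsets of [D] is enough. *)
Lemma ge0_le_integral_set_function mu mu' D f (c : R) : (0 <= c)%R ->
  mu set0 = 0 -> mu' set0 = 0 ->
  (forall A, measurable A -> 0 <= mu A) -> (forall A, measurable A -> 0 <= mu' A) ->
  (forall A, measurable A -> A `<=` D -> mu A <= c%:E * mu' A) ->
  (forall x, D x -> 0 <= f x) ->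
  \int[mu]_(x in D) f x <= c%:E * \int[mu']_(x in D) f x.
Proof.
move=> c0 mu0 mu'0 mu_ge0 mu'_ge0 le_mu f0.
rewrite (ge0_integral_set_functionE mu0 mu_ge0 f0).
rewrite (ge0_integral_set_functionE mu'0 mu'_ge0 f0).
apply: ge_ereal_sup => _ [h /= hf <-].
apply: (@le_trans _ _ (c%:E * sintegral mu' h)); last first.
  by rewrite lee_wpmul2l ?lee_fin//; apply: ereal_sup_ubound; exists h.
rewrite !sintegral_range// ge0_mule_fsumr; last first.
  move=> x; have [x0|x0] := leP 0%R x; first by rewrite mule_ge0 ?lee_fin ?mu'_ge0.
  rewrite preimage10 ?mu'0 ?mule0// => -[y _ hy].
  by move: x0; rewrite -hy ltNge fun_ge0.
apply: lee_fsum => // x _; rewrite muleCA.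
have [->|x0] := eqVneq x 0%R; first by rewrite !mul0e.
have [[y hy]|nx] := pselect (exists y, h y = x); last first.
  by rewrite preimage10 ?mu0 ?mu'0 ?mule0// => -[y _ hy]; apply: nx; exists y.
rewrite lee_wpmul2l ?lee_fin -?hy//; apply: le_mu => // z /= hz.
apply: contrapT => nDz; have := hf z; rewrite /patch memNset// lee_fin hz hy.
by move=> x_le0; move: x0; rewrite eq_le x_le0 -hy fun_ge0.
Qed.

Lemma integral_set_function_ge0 mu D f : mu set0 = 0 ->
  (forall A, measurable A -> 0 <= mu A) -> (forall x, D x -> 0 <= f x) ->
  0 <= \int[mu]_(x in D) f x.
Proof.
move=> mu0 mu_ge0 f0; rewrite ge0_integral_set_functionE//.
apply: (@le_trans _ _ (sintegral mu (@nnsfun0 _ T R))); last first.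
  apply: ereal_sup_ubound; exists (@nnsfun0 _ T R) => // x /=.
  by rewrite /patch; case: ifPn => // /set_mem; exact: f0.
by rewrite sintegral_range// fsbig1// => _ [x _ <-]; rewrite mul0e.
Qed.

Lemma integral_set_function_subset mu D D' f : mu set0 = 0 ->
  (forall A, measurable A -> 0 <= mu A) -> D `<=` D' ->
  (forall x, D' x -> 0 <= f x) ->
  \int[mu]_(x in D) f x <= \int[mu]_(x in D') f x.
Proof.
move=> mu0 mu_ge0 DD' f0; rewrite !ge0_integral_set_functionE//; last first.
  by move=> x /DD'; exact: f0.
apply: le_ereal_sup => _ [h /= hf <-]; exists h => // x.
apply: le_trans (hf x) _; rewrite /patch; case: ifPn => [/set_mem Dx|_].
  by rewrite mem_set//; exact: DD'.
by case: ifPn => // /set_mem; exact: f0.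
Qed.

(** This is the half of additivity that a finite variation has by merely joining partitions, and it
    determines the integrals of indicators. *)
Definition superadditive mu := forall A B, measurable A -> measurable B ->
  A `&` B = set0 -> mu A + mu B <= mu (A `|` B).

Section superadditive_set_function.
Variable mu : set T -> \bar R.
Hypothesis mu0 : mu set0 = 0.
Hypothesis mu_ge0 : forall A, measurable A -> 0 <= mu A.
Hypothesis mu_super : superadditive mu.

Lemma superadditive_le A B : measurable A -> measurable B -> A `<=` B ->
  mu A <= mu B.
Proof.
move=> mA mB AB; have mBA : measurable (B `\` A) by exact: measurableD.
have := mu_super mA mBA; rewrite setDIK => /(_ erefl); rewrite setDUK//;
  apply: le_trans.
by rewrite leeDl// mu_ge0.
Qed.

Lemma measurable_preimage_seq (h : {nnsfun T >-> R}) (s : seq R) :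
  measurable (h @^-1` [set` s]).
Proof.
rewrite -[X in measurable X]setTI; apply: measurable_funP => //.
apply: countable_measurable => [x|]; first exact: measurable_set1.
exact/finite_set_countable/finite_seq.
Qed.

Lemma superadditive_fset (h : {nnsfun T >-> R}) (s : seq R) : uniq s ->
  \sum_(x <- s) mu (h @^-1` [set x]) <= mu (h @^-1` [set` s]).
Proof.
elim: s => [_|x s IH /andP[xs us]]; first by rewrite big_nil mu_ge0//;
  exact: measurable_preimage_seq.
have -> : h @^-1` [set` x :: s] = h @^-1` [set x] `|` h @^-1` [set` s].
  apply/seteqP; split=> y /=; first by rewrite inE => /predU1P[|]; [left|right].
  by rewrite inE => -[->|->]; rewrite ?eqxx ?orbT.
rewrite big_cons.
apply: le_trans (mu_super _ _ _); [by rewrite leeD2l// IH|by []|exact: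
  measurable_preimage_seq|].
apply/seteqP; split=> // y [/= -> ys].
by rewrite ys in xs.
Qed.

(** A simple function below c 1_A on [D] has values at most [c], and its nonzero level sets are
    disjoint subsets of the intersection of [A] and [D], so superadditivity bounds its integral. The
    indicator of the intersection, scaled by [c], attains the bound. *)
Lemma integral_scaled_indic D A (c : R) : measurable D -> measurable A ->
  (0 < c)%R -> \int[mu]_(x in D) (c * \1_A x)%:E = c%:E * mu (A `&` D).
Proof.
move=> mD mA c0; have mAD := measurableI _ _ mA mD.
rewrite ge0_integral_set_functionE//; last first.
  by move=> x _; rewrite lee_fin mulr_ge0 ?(ltW c0)// indicE.
apply/eqP; rewrite eq_le; apply/andP; split.
  apply: ge_ereal_sup => _ [h /= hf <-].
  have hle x : (h x <= c)%R.
    have := hf x; rewrite /patch; case: ifPn => _; rewrite lee_fin => hx.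
      by rewrite (le_trans hx)// ler_piMr ?(ltW c0)// indicE lern1 leq_b1.
    by rewrite (le_trans hx)// ltW.
  have finP : finite_set (range h `&` [set~ 0%R]) by exact: finite_setIl.
  rewrite sintegral_range// -(@fsbig_widen _ _ _ _ (range h `&` [set~
    0%R]))//=; last first.
    by move=> x [xh /not_andP[//|/contrapT -> /=]]; rewrite mul0e.
  apply: (@le_trans _ _ (\sum_(x \in range h `&` [set~ 0%R]) (c%:E * mu (h
    @^-1` [set x])))).
    apply: lee_fsum => // _ [[y _ <-] _]; apply: lee_wpmul2r;
      last by rewrite lee_fin.
    exact: mu_ge0.
  rewrite -ge0_mule_fsumr; last by move=> x; exact: mu_ge0.
  rewrite lee_wpmul2l ?lee_fin ?(ltW c0)// fsbig_finite//.
  apply: le_trans (superadditive_fset _ (fset_uniq _)) _.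
  apply: superadditive_le => //; first exact: measurable_preimage_seq.
  move=> x; rewrite /= in_fset_set// => /set_mem[_ /= hx0].
  have := hf x; rewrite /patch; case: ifPn => [/set_mem Dx|_]; last first.
    by rewrite lee_fin => hx; case: hx0; apply/eqP; rewrite eq_le hx fun_ge0.
  rewrite indicE; case: (boolP (x \in A)) => [/set_mem//|_].
  rewrite mulr0 lee_fin => hx; case: hx0; apply/eqP.
  by rewrite eq_le hx fun_ge0.
have c0' : (0 <= c)%R by exact: ltW.
pose g := scale_nnsfun (indic_nnsfun R mAD) c0'.
have gE x : g x = (c * \1_(A `&` D) x)%R by [].
apply: ereal_sup_ubound; exists g => /=.
  move=> x; rewrite [mindic _ _ _](_ : _ = \1_A x * \1_D x)%R; last first.
    by rewrite /mindic indicI.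
  rewrite /patch; case: ifPn => Dx; rewrite lee_fin [\1_D x]indicE.
    by rewrite Dx mulr1.
  by rewrite (negbTE Dx) !mulr0.
rewrite -[X in sintegral mu X]/(g : T -> R) sintegral_range//.
have cN0 : 0%R <> c by apply/eqP; rewrite lt_eqF.
(* The range may miss [c], when [A] and [D] are disjoint, or 0; the missing value has an empty
   preimage, of [mu] 0. *)
rewrite (@fsbig_widen _ _ _ _ _ [set 0%R; c]); last 2 first.
- move=> _ [x _ <-]; rewrite gE indicE.
  by case: (x \in _) => /=; rewrite ?mulr1 ?mulr0; [right|left].
- move=> x [_] nx /=; rewrite preimage10 ?mu0 ?mule0//.
rewrite fsbigU//=; last by move=> x [->].
rewrite !fsbig_set1 mul0e add0e; congr (_ * mu _).
have hE x : (g x = c) <-> (A `&` D) x.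
  rewrite gE indicE; case: (boolP (x \in _)) => [/set_mem xAD|/negP nxAD].
    by rewrite mulr1.
  by rewrite mulr0; split=> // /mem_set.
by apply/seteqP; split=> x /hE.
Qed.

End superadditive_set_function.

End integral_set_function.

(** * The Cesaro operator on indicators *)

Section lebesgue_facts.
Context {R : realType}.
Implicit Types (S : set (Leb R)) (x : Leb R).

Lemma lambda_lebesgue (S : set R) : lambda (S : set (Leb R)) = lebesgue_measure S.
Proof. by []. Qed.

Lemma measurable_borel (S : set (measurableTypeR R)) :
  measurable S -> measurable (S : set (Leb R)).
Proof. move=> mS. exact: sub_caratheodory. Qed.

Lemma measurable_itvL (i : interval R) : measurable ([set` i] : set (Leb R)).
Proof. by apply: measurable_borel; exact: measurable_itv. Qed.

Lemma measurable_leb_fun (D : set (Leb R)) (f : R -> R) :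
  measurable_fun [set: measurableTypeR R] f -> measurable D ->
  measurable_fun D (f : Leb R -> R).
Proof.
move=> mf mD _ B mB; apply: measurableI => //.
apply: measurable_borel; rewrite -[X in measurable X]setTI; exact: mf.
Qed.

Lemma lambda_itv_cc (a b : R) : a <= b -> lambda (`[a,
  b]%classic : set (Leb R)) = (b - a)%:E.
Proof.
move=> ab; rewrite lambda_lebesgue lebesgue_measure_itv/= lte_fin.
by case: ltgtP ab => // ->; rewrite subrr.
Qed.

Lemma lambda_itv_oc (a b : R) : a <= b -> lambda (`]a,
  b]%classic : set (Leb R)) = (b - a)%:E.
Proof.
move=> ab; rewrite lambda_lebesgue lebesgue_measure_itv/= lte_fin.
by case: ltgtP ab => // ->; rewrite subrr.
Qed.

Lemma lambda_le S S' : measurable S -> measurable S' -> S `<=` S' ->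
  (lambda S <= lambda S')%E.
Proof. move=> mS mS' SS'; by apply: le_measure => //; exact: mem_set. Qed.

Lemma integrable_indic_lambda S S' : measurable S -> measurable S' ->
  (lambda S' < +oo)%E -> lambda.-integrable S' (EFin \o \1_S).
Proof.
move=> mS mS' S'oo; apply/integrableP; split.
  by apply/measurable_EFinP; exact: measurable_indic.
under eq_integral do rewrite abse_EFin ger0_norm//.
rewrite integral_indic//; apply: le_lt_trans S'oo.
by apply: lambda_le => //; exact: measurableI.
Qed.

Lemma lambda_cap_fin S x : measurable S ->
  lambda (S `&` (`[0, x]%classic : set (Leb R))) \is a fin_num.
Proof.
move=> mS; have mi := measurable_itvL `[0, x]; rewrite ge0_fin_numE//.
apply: (@le_lt_trans _ _ (lambda (`[0, x]%classic : set (Leb R)))).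
  by apply: lambda_le => //; exact: measurableI.
have [x0|x0] := leP 0 x; first by rewrite lambda_itv_cc// ltry.
by rewrite set_itv_ge -?ltNge// measure0.
Qed.

Lemma cesaro_measureE S x : measurable S ->
  cesaro_measure S x = (x : R)^-1 * fine (lambda (S `&` (`[0,
    x]%classic : set (Leb R)))).
Proof.
by move=> mS; rewrite /cesaro_measure /Defs.cesaro /Rintegral integral_indic//;
  exact: measurable_itvL.
Qed.

Lemma cesaroZ_indic S (c : R) x : measurable S -> 0 <= c ->
  Defs.cesaro (fun y => `|c * \1_S y|) x = c * cesaro_measure S x.
Proof.
move=> mS c0; rewrite /cesaro_measure /Defs.cesaro  mulrCA; congr (_ * _).
have mi := measurable_itvL `[0, x : R].
rewrite -RintegralZl//; last first.
  apply: integrable_indic_lambda => //.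
  have := lambda_cap_fin x measurableT; rewrite setTI.
  by rewrite ge0_fin_numE.
by apply: eq_Rintegral => y _; rewrite ger0_norm ?mulr_ge0// indicE.
Qed.

(** At 0 this rests on the convention that 0 has inverse 0; for negative [x] the interval of
    integration is empty. Thanks to these values the estimates below hold at every real [x]. *)
Lemma cesaro_measure_nonpos S x : measurable S -> (x : R) <= 0 ->
  cesaro_measure S x = 0.
Proof.
move=> mS; rewrite le_eqVlt => /predU1P[->|x0].
  by rewrite /cesaro_measure /Defs.cesaro  invr0 mul0r.
by rewrite cesaro_measureE// set_itv_ge -?ltNge// setI0 measure0/= mulr0.
Qed.

Lemma cesaro_measure_ge0 S x : measurable S -> 0 <= cesaro_measure S x.
Proof.
move=> mS; have [x0|/ltW x0] := leP 0 (x : R);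
  last by rewrite cesaro_measure_nonpos.
by rewrite cesaro_measureE// mulr_ge0 ?invr_ge0// fine_ge0.
Qed.

Lemma cesaro_measure_le S T x : measurable S -> measurable T -> S `<=` T ->
  cesaro_measure S x <= cesaro_measure T x.
Proof.
move=> mS mT ST; have [x0|/ltW x0] := leP 0 (x : R);
  last by rewrite !cesaro_measure_nonpos.
rewrite !cesaro_measureE// ler_wpM2l ?invr_ge0// fine_le ?lambda_cap_fin//.
have mi := measurable_itvL `[0, x : R].
by apply: lambda_le; [exact: measurableI|exact: measurableI|exact: setSI].
Qed.

Lemma cesaro_measure_le1 S x : measurable S -> cesaro_measure S x <= 1.
Proof.
move=> mS; have [x0|x0] := leP (x : R) 0; first by rewrite cesaro_measure_nonpos.
apply: le_trans (cesaro_measure_le x mS measurableT (@subsetT _ _)) _.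
rewrite cesaro_measureE// setTI lambda_itv_cc ?(ltW x0)//= subr0 mulVf//.
by rewrite gt_eqF.
Qed.

Lemma cesaro_measureD S T : measurable S -> measurable T -> S `&` T = set0 ->
  cesaro_measure (S `|` T) = cesaro_measure S + cesaro_measure T.
Proof.
move=> mS mT ST0; apply/funext => x.
have mi := measurable_itvL `[0, x : R].
rewrite fctE !cesaro_measureE//; last exact: measurableU.
rewrite -mulrDr -fineD ?lambda_cap_fin// setIUl measureU//.
- exact: measurableI.
- exact: measurableI.
- by rewrite setIACA ST0 set0I.
Qed.

(** On the positive half-line the function is the product of the continuous 1/x and a nondecreasing
    function, hence even Borel measurable; elsewhere it is 0. *)
Lemma measurable_cesaro_measure S (D : set (Leb R)) : measurable S ->
  measurable D ->
  measurable_fun D (cesaro_measure S).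
Proof.
move=> mS mD; pose g : measurableTypeR R -> R := cesaro_measure S.
suff mg : measurable_fun [set: measurableTypeR R] g by exact:
  measurable_leb_fun mg mD.
rewrite -(setUv `]-oo, 0%R]%classic) setCitvl; apply/measurable_funU => //; split.
  apply: (@eq_measurable_fun _ _ (measurableTypeR R) R _ (cst 0) g) => // x.
  by move=> /set_mem/=; rewrite in_itv/= => x0; rewrite /g cesaro_measure_nonpos.
apply: (@eq_measurable_fun _ _ (measurableTypeR R) R _ (fun x : R => x^-1 *
    fine (lambda (S `&` (`[0, x]%classic : set (Leb R))))) g) => [x _|].
  by rewrite /g cesaro_measureE.
apply: measurable_funM.
  apply: open_continuous_measurable_fun; first exact: interval_open.
  move=> x /set_mem/=; rewrite in_itv/= andbT => x0.
  by apply: inv_continuous; rewrite gt_eqF.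
apply: measurable_funTS; apply: nondecreasing_measurable => // x y xy.
have mi z := measurable_itvL `[0, z : R].
rewrite fine_le ?lambda_cap_fin//.
apply: lambda_le; [exact: measurableI|exact: measurableI|].
by apply: setIS => z /=; rewrite !in_itv/= => /andP[-> /le_trans]; apply.
Qed.

End lebesgue_facts.

(** * Rearrangement invariant spaces *)

Section ri_space_facts.
Context {R : realType} (X : fspace R).
Hypothesis hX : ri_space X.
Implicit Types (f g h : Leb R -> R) (S : set (Leb R)).

Let bX : banach_function_space X. Proof. by case: hX. Qed.
Let sX : seminormed X := bfs_seminormed bX.

Lemma measurable_I01 : measurable (@I01 R).
Proof. exact: measurable_itvL. Qed.

Lemma lambda_I01 : lambda (@I01 R) = 1%E.
Proof. by rewrite /I01 lambda_itv_cc// subr0. Qed.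

(** The point 0 is null and is left out because Cesaro means take a conventional value there. *)
Lemma bfs_ideal_pos f g : X f -> measurable_fun I01 g ->
  (forall x : R, 0 < x <= 1 -> `|g x| <= `|f x|) ->
  X g /\ sp_norm X g <= sp_norm X f.
Proof.
have [_ _ _ h _] := bX => Xf mg gf; apply: h => //.
exists [set 0 : R]; split.
- by rewrite -set_itv1; exact: measurable_itvL.
- by rewrite -set_itv1 lambda_itv_cc// subrr.
- move=> x /= /not_implyP[Ix gfx]; apply: contrapT => x0; apply: gfx.
  apply: gf; move: Ix; rewrite /I01/= in_itv/= => /andP[x_ge0 ->].
  by rewrite andbT lt0r x_ge0 andbT; apply/eqP.
Qed.

(** A smaller distribution function enlarges the set of levels of which the rearrangement is the
    infimum. *)
Lemma ri_distribution f g : X f -> measurable_fun I01 g ->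
  (forall tau, 0 <= tau -> (Defs.distribution g tau <= Defs.distribution f
    tau)%E) ->
  X g /\ sp_norm X g <= sp_norm X f.
Proof.
have [_ ri _] := hX => Xf mg gf; apply: ri => // t _.
apply: le_ereal_inf => _ [tau [tau0 ftau] <-]; exists tau => //; split=> //.
exact: le_trans (gf _ tau0) ftau.
Qed.

Lemma distribution_indic S tau : 0 <= tau ->
  Defs.distribution \1_S tau = if tau < 1 then lambda (I01 `&` S) else 0%E.
Proof.
move=> tau0; rewrite /Defs.distribution; case: ifPn => tau1.
  congr (lambda (_ `&` _)); apply/seteqP; split=> x /=; rewrite indicE.
    by case: (boolP (x \in S)) => [/set_mem//|_]; rewrite normr0 ltNge tau0.
  by move=> Sx; rewrite mem_set// normr1.
rewrite [X in I01 `&` X](_ : _ = set0) ?setI0 ?measure0// -subset0 => x /=.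
rewrite indicE ger0_norm// => tx; move/negP: tau1; apply.
by rewrite (lt_le_trans tx)// lern1 leq_b1.
Qed.

Lemma measurable_levelset f (tau : R) : measurable_fun I01 f ->
  measurable (I01 `&` [set x | tau < `|f x|]).
Proof.
move=> mf; have -> : [set x | tau < `|f x|] = (fun x => `|f x|) @^-1` `]tau,
  +oo[%classic.
  by apply/seteqP; split=> x /=; rewrite in_itv/= andbT.
have mI := measurable_I01.
have : measurable_fun I01 (fun x => `|f x|) by exact: measurableT_comp.
by move=> /(_ mI _ (measurable_itv `]tau, +oo[)).
Qed.

Lemma measurable_indic_I01 S : measurable S -> measurable_fun I01 (\1_S : Leb R ->
  R).
Proof. by move=> mS; exact: measurable_indic. Qed.

Lemma ri_indic_exists : exists S, [/\ measurable S, S `<=` I01,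
  (0 < lambda S)%E & X \1_S].
Proof.
have [_ _ [f Xf nf0]] := hX.
have mf := bfs_measurable bX Xf.
pose S n := I01 `&` [set x | n.+1%:R^-1 < `|f x|].
have mS n : measurable (S n) by exact: measurable_levelset.
have [[n Sn]|nS] := pselect (exists n, (0 < lambda (S n))%E).
  exists (S n); split=> //; first exact: subIsetl.
  apply: (bfs_ideal bX (seminormedZ n.+1%:R sX Xf) (measurable_indic_I01 (mS
    n)) _).1.
  move=> x _; rewrite indicE fctE normrM.
  case: (boolP (x \in S n)) => [/set_mem[_ /=]|_]; last by rewrite normr0 mulr_ge0.
  rewrite normr1 normr_nat => /ltW.
  by rewrite -div1r ler_pdivrMr// mulrC.
exfalso; apply: nf0.
apply: (@negligibleS _ _ _ _ (\bigcup_n S n)); last first.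
  apply: negligible_bigcup => n; exists (S n); split=> //.
  apply/eqP; rewrite eq_le measure_ge0 andbT leNgt; apply/negP => Sn.
  by apply: nS; exists n.
move=> x /= /not_implyP[Ix /eqP fx].
have /ltr_add_invr[n] : 0 < `|f x| by rewrite normr_gt0.
by rewrite add0r => nx; exists n.
Qed.

(** Some indicator of a set [S] of positive measure lies in [X]. If 1/(n+1) is below the measure of
    [S], rearrangement invariance transfers membership to every interval of length 1/(n+1), and n+1
    of them cover [0, 1]. *)
Lemma ri_one : X (cst 1).
Proof.
have [S [mS SI S0 XS]] := ri_indic_exists.
have Sfin : lambda S \is a fin_num.
  rewrite ge0_fin_numE//; apply: le_lt_trans (lambda_le mS measurable_I01 SI) _.
  by rewrite lambda_I01 ltry.
have /ltr_add_invr[n] : 0 < fine (lambda S).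
  by rewrite fine_gt0// S0/= -ge0_fin_numE.
rewrite add0r => nS.
have XE k : (k <= n)%N -> X \1_(`[k%:R / n.+1%:R,
  k.+1%:R / n.+1%:R]%classic : set (Leb R)).
  move=> kn; set E : set (Leb R) := `[k%:R / n.+1%:R, k.+1%:R / n.+1%:R]%classic.
  have mE : measurable E by exact: measurable_itvL.
  apply: (ri_distribution XS (measurable_indic_I01 mE) _).1 => tau tau0.
  rewrite !distribution_indic//; case: ifPn => // _.
  have -> : I01 `&` S = S by apply/setIidPr.
  apply: le_trans (lambda_le (measurableI _ _ measurable_I01 mE) mE (@subIsetr
    _ _ _)) _.
  rewrite lambda_itv_cc ?ler_pM2r ?invr_gt0 ?ler_nat//.
  rewrite -(fineK Sfin) lee_fin -mulrBl -[k.+1]addn1 natrD addrAC subrr add0r mul1r.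
  exact: ltW.
suff XI k : (k <= n.+1)%N -> X \1_(`[0, k%:R / n.+1%:R]%classic : set (Leb R)).
  have := XI n.+1 (leqnn _); rewrite divff// => X1.
  apply: (bfs_ideal bX X1 _ _).1 => // x Ix; rewrite indicE mem_set// normr1//.
elim: k => [_|k IH kn].
  apply: (bfs_ideal_pos (f := 0) _ _ _).1; first by case: sX.
    by apply: measurable_indic_I01; exact: measurable_itvL.
  move=> x /andP[x0 _]; rewrite indicE memNset ?normr0// /= in_itv/= mul0r.
  by rewrite [x <= 0]leNgt x0 andbF.
apply: (bfs_ideal bX (seminormedD sX (IH (ltnW kn)) (XE k _)) _ _).1 => //.
  by apply: measurable_indic_I01; exact: measurable_itvL.
move=> x _; rewrite fctE !indicE !ger0_norm ?addr_ge0// -natrD ler_nat.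
case: (boolP (x \in _)) => // /set_mem/=; rewrite in_itv/= => /andP[x0 xk].
have [xk'|xk'] := leP x (k%:R / n.+1%:R).
  by rewrite mem_set//= in_itv/= x0.
by rewrite addnC mem_set//= in_itv/= (ltW xk').
Qed.

Lemma ri_bounded g c : 0 <= c -> measurable_fun I01 g ->
  (forall x : R, 0 < x <= 1 -> `|g x| <= c) ->
  X g /\ sp_norm X g <= c * sp_norm X (cst 1).
Proof.
move=> c0 mg gc; have [_ _ _ nZ _] := sX.
rewrite -[c]ger0_norm// -nZ; last exact: ri_one.
apply: bfs_ideal_pos => //; first by apply: seminormedZ => //; exact: ri_one.
by move=> x Ix; rewrite fctE normrM normr1 mulr1 (le_trans (gc _ Ix))// ler_norm.
Qed.

Lemma ri_indic S : measurable S -> X \1_S.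
Proof.
move=> mS; apply: (ri_bounded (c := 1) _ _ _).1 => //.
by move=> x _; rewrite indicE ger0_norm// lern1 leq_b1.
Qed.

Lemma ri_norm_indic_gt0 S : measurable S -> S `<=` I01 -> (0 < lambda S)%E ->
  0 < sp_norm X \1_S.
Proof.
move=> mS SI S0; have XS := ri_indic mS; have [_ _ n0 _ _] := sX.
rewrite lt0r n0// andbT; apply/eqP => nS0.
have [_ _ [_ nE _ _] _ _] := bX.
have [/(_ nS0) [N [mN N0 SN]] _] := nE _ XS.
move: S0; rewrite ltNge => /negP; apply; rewrite -N0; apply: lambda_le => //.
move=> x Sx; apply: SN => /= /(_ (SI _ Sx)); rewrite indicE mem_set// => /eqP.
by rewrite oner_eq0.
Qed.

Lemma ri_one_gt0 : 0 < sp_norm X (cst 1).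
Proof.
have le1 (x : R) : 0 < x <= 1 -> `|\1_(@I01 R) x| <= 1 :> R.
  by move=> _; rewrite indicE ger0_norm// lern1 leq_b1.
have [_] := ri_bounded ler01 (measurable_indic_I01 measurable_I01) le1.
rewrite mul1r; apply: lt_le_trans; apply: ri_norm_indic_gt0 => //.
  exact: measurable_I01.
by rewrite lambda_I01 lte01.
Qed.

Lemma ri_cesaro_measure S : measurable S -> X (cesaro_measure S).
Proof.
move=> mS; apply: (ri_bounded (c := 1) _ _ _).1 => //.
  by apply: measurable_cesaro_measure => //; exact: measurable_I01.
by move=> x _; rewrite ger0_norm ?cesaro_measure_ge0// cesaro_measure_le1.
Qed.

End ri_space_facts.

(** * Non-reflexivity of spaces whose norm is comparable with the L^1 norm on [Jhalf] *)

Section mass_escaping_to_one_half.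
Context {R : realType} (Y : fspace R).
Implicit Types (f g : Leb R -> R) (S D : set (Leb R)).

Definition Jhalf : set (Leb R) := `]2^-1, 3 / 4]%classic.

Hypothesis norm_ge0 : forall f, Y f -> 0 <= sp_norm Y f.
Variables (M C : R).
Hypothesis M0 : 0 < M.
Hypothesis Yindic : forall (c : R) S, 0 < c -> measurable S -> S `<=` Jhalf ->
  Y (c *: \1_S) /\ sp_norm Y (c *: \1_S) <= c * (M * fine (lambda S)).
Hypothesis Ymeas : forall f, Y f -> measurable_fun I01 f.
Hypothesis Yint : forall f, Y f ->
  (\int[lambda]_(x in Jhalf) `|f x|%:E <= (C * sp_norm Y f)%:E)%E.

Let mJ : measurable Jhalf. Proof. exact: measurable_itvL. Qed.

Let JI : Jhalf `<=` I01.
Proof.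
by move=> x; rewrite /Jhalf /I01/= !in_itv/= => /andP[a b]; apply/andP; split; lra.
Qed.

Let Yintegrable f : Y f -> lambda.-integrable Jhalf (EFin \o f).
Proof.
move=> Yf; apply/integrableP; split; last first.
  by apply: le_lt_trans (Yint Yf) _; rewrite ltry.
apply/measurable_EFinP; apply: measurable_funS (Ymeas Yf) => //.
exact: measurable_I01.
Qed.

Let psi D f : R := \int[lambda]_(x in D) f x.

Let dual_psi D : measurable D -> D `<=` Jhalf -> dual Y (psi D).
Proof.
move=> mD DJ; have Yi f : Y f -> lambda.-integrable D (EFin \o f).
  by move=> /Yintegrable; exact: integrableS.
split=> [a f g Yf Yg|].
  have iaf : lambda.-integrable D (EFin \o (fun x => a * f x)).
    exact: (integrableZl mD a (Yi _ Yf)).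
  by rewrite /psi -RintegralZl//; [exact: (RintegralD mD iaf (Yi _ Yg))|exact: Yi].
exists C => f Yf; rewrite -lee_fin.
apply: le_trans (Yint Yf); rewrite /psi EFin_normr_Rintegral//; last exact: Yi.
apply: le_trans (le_abse_integral _ mD (measurable_int _ (Yi _ Yf))) _.
apply: ge0_subset_integral => //.
by apply: measurableT_comp => //; have /integrableP[] := Yintegrable Yf.
Qed.

Let A n : set (Leb R) := `]2^-1, 2^-1 + (4 * n.+1%:R)^-1]%classic.

Let A_gap n : 0 < (4 * n.+1%:R : R)^-1 <= 4^-1.
Proof.
rewrite invr_gt0 mulr_gt0//= lef_pV2 ?posrE ?mulr_gt0//.
by rewrite ler_pMr// ler1n.
Qed.

Let AJ n : A n `<=` Jhalf.
Proof.
move=> x; rewrite /A /Jhalf/= !in_itv/= => /andP[-> xn]/=.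
by move: xn (A_gap n); move: (_ * _)^-1 => t xn /andP[_]; lra.
Qed.

Let mA n : measurable (A n). Proof. exact: measurable_itvL. Qed.

Let lambda_A n : lambda (A n) = ((4 * n.+1%:R)^-1)%:E.
Proof.
rewrite lambda_itv_oc; last by have /andP[/ltW] := A_gap n; rewrite lerDl.
by rewrite addrAC subrr add0r.
Qed.

(** The factor 4(n+1) is the inverse of the measure of [A n], and 1/M brings the norm down to at
    most 1; the integral over [Jhalf] is 1/M for every n. *)
Let f n : Leb R -> R := ((4 * n.+1%:R) / M) *: \1_(A n).

Let c_gt0 n : 0 < (4 * n.+1%:R) / M :> R.
Proof. by rewrite divr_gt0// mulr_gt0. Qed.

Let psif D n : measurable D -> D `<=` Jhalf ->
  psi D (f n) = 4 * n.+1%:R / M * fine (lambda (A n `&` D)).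
Proof.
move=> mD DJ; rewrite /psi /f RintegralZl//; last first.
  apply: integrable_indic_lambda => //.
  apply: le_lt_trans (lambda_le mD mJ DJ) _.
  by rewrite lambda_itv_oc ?ltry//; lra.
by rewrite /Rintegral integral_indic.
Qed.

(** This starts at the right end of [A k], hence misses [A n] for all n >= k, and it increases with
    k to ]1/2, +oo[. *)
Let P k : set (Leb R) := `]2^-1 + (4 * k.+1%:R)^-1, +oo[%classic.

Lemma not_reflexive_escaping_mass : ~ reflexive_space Y.
Proof.
have mP k : measurable (P k) by exact: measurable_itvL.
apply: (@not_reflexive _ _ Y f (fun k => psi (Jhalf `&` P k)) (psi Jhalf) M^-1) =>
  //.
- by move=> n; exact: (Yindic (c_gt0 n) (mA n) (@AJ n)).1.
- move=> n; apply: le_trans (Yindic (c_gt0 n) (mA n) (@AJ n)).2 _.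
  rewrite lambda_A/= le_eqVlt; apply/orP; left; apply/eqP; field.
  by rewrite nat1r pnatr_eq0/= gt_eqF.
- by move=> k; apply: dual_psi; [exact: measurableI|exact: subIsetl].
- exact: dual_psi.
- move=> k n kn; rewrite psif; [|exact: measurableI|exact: subIsetl].
  suff -> : A n `&` (Jhalf `&` P k) = set0 by rewrite measure0/= mulr0.
  rewrite -subset0 => x [An [_ Px]].
  move: An Px; rewrite /A /P/= !in_itv/= andbT => /andP[_ xn] kx.
  have := lt_le_trans kx xn; rewrite ltrD2l ltf_pV2 ?posrE ?mulr_gt0//.
  by rewrite ltr_pM2l// ltr_nat ltnS ltnNge kn.
- by rewrite invr_eq0 gt_eqF.
- move=> n; rewrite psif// (setIidl (@AJ n)) lambda_A/=.
  by field; rewrite nat1r pnatr_eq0/= gt_eqF.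
move=> g Yg; have ig := Yintegrable Yg.
apply: fine_cvg; rewrite fineK; last exact: integrable_fin_num.
under eq_cvg do rewrite integral_mkcondr.
(* Every x > 1/2 lies in [P k] for all large k, so the restricted integrands are eventually constant
   at each point of [Jhalf], and |g| dominates them. *)
apply: (@dominated_cvg _ _ _ lambda Jhalf mJ _ _ (fun x => `|g x|%:E)).
- move=> k; apply/measurable_restrict => //.
  by apply: measurable_funS (measurable_int _ ig) => //; exact: subIsetr.
- move=> x; rewrite /Jhalf/= in_itv/= => /andP[x2 _].
  have /ltr_add_invr[N] : 0 < x - 2^-1 :> R by rewrite subr_gt0.
  rewrite add0r => Nx; apply: cvg_near_cst; exists N => // k /= Nk.
  rewrite patchT//; apply: mem_set; rewrite /P/= in_itv/= andbT -ltrBrDl;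
    apply: le_lt_trans Nx.
  rewrite lef_pV2 ?posrE ?mulr_gt0//.
  by rewrite (@le_trans _ _ k.+1%:R) ?ler_nat// ler_peMl// ler1n.
- by [].
- exact: (integrable_abse ig).
- move=> k x _; rewrite /patch; case: ifPn => // _.
  by rewrite abse0 lee_fin.
Qed.

End mass_escaping_to_one_half.

(** * Cesaro means of the two halves of [0, 1] *)

Section cesaro_halves.
Context {R : realType}.
Implicit Types (S : set (Leb R)) (x : Leb R).

Definition lower_half : set (Leb R) := `]0, 2^-1]%classic.
Definition upper_half : set (Leb R) := `]2^-1, 1]%classic.

Lemma measurable_lower_half : measurable lower_half.
Proof. exact: measurable_itvL. Qed.

Lemma measurable_upper_half : measurable upper_half.
Proof. exact: measurable_itvL. Qed.

Lemma cesaro_measure_lower_half (x : R) : 0 < x <= 1 ->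
  (x <= 2^-1 -> 1 <= cesaro_measure lower_half x) /\
  2^-1 <= cesaro_measure lower_half x.
Proof.
move=> /andP[x0 x1]; rewrite cesaro_measureE; last exact: measurable_lower_half.
have [xle|xgt] := leP x 2^-1.
  have -> : lower_half `&` (`[0, x]%classic : set (Leb R)) = `]0, x]%classic.
    apply/seteqP; split=> y; rewrite /lower_half/= !in_itv/=.
      by move=> [/andP[-> _] /andP[]].
    by move=> /andP[y0 yx]; rewrite y0 (ltW y0) yx (le_trans yx xle).
  rewrite lambda_itv_oc ?(ltW x0)//= subr0 mulVf ?gt_eqF//; split=> //.
  by rewrite invf_le1// ler1n.
have -> : lower_half `&` (`[0, x]%classic : set (Leb R)) = lower_half.
  apply: setIidl => y; rewrite /lower_half/= !in_itv/= => /andP[y0 yx].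
  by rewrite (ltW y0) (le_trans yx (ltW xgt)).
split; first by [].
rewrite lambda_itv_oc//= subr0 mulrC ler_pdivlMr//; lra.
Qed.

Lemma cesaro_measure_upper S (x : R) : measurable S -> S `<=` upper_half ->
  0 < x <= 1 -> cesaro_measure S x <= 2 * fine (lambda S).
Proof.
move=> mS SU /andP[x0 x1]; rewrite cesaro_measureE//.
have mi := measurable_itvL `[0, x].
have Sfin : lambda S \is a fin_num.
  rewrite ge0_fin_numE//; apply: le_lt_trans (lambda_le mS
    measurable_upper_half SU) _.
  by rewrite lambda_itv_oc ?ltry// invf_le1// ler1n.
have [xle|xgt] := leP x 2^-1.
  have -> : S `&` (`[0, x]%classic : set (Leb R)) = set0.
    rewrite -subset0 => y [/SU]; rewrite /upper_half/= !in_itv/= =>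
      /andP[y2 _] /andP[_ yx].
    by have := lt_le_trans y2 (le_trans yx xle); rewrite ltxx.
  by rewrite measure0/= mulr0 mulr_ge0// fine_ge0.
apply: ler_pM; rewrite ?invr_ge0 ?fine_ge0 ?(ltW x0)//.
  by rewrite -[leRHS]invrK lef_pV2 ?posrE// ltW.
apply: fine_le => //; first exact: lambda_cap_fin.
by apply: lambda_le => //; exact: measurableI.
Qed.

(** Beyond 1/2 the mean is (x - 1/2)/x = 1 - 1/(2x), largest at x = 1. *)
Lemma cesaro_measure_upper_half (x : R) : 0 < x <= 1 ->
  cesaro_measure upper_half x <= 2^-1.
Proof.
move=> /andP[x0 x1]; rewrite cesaro_measureE; last exact: measurable_upper_half.
have [xle|xgt] := leP x 2^-1.
  have -> : upper_half `&` (`[0, x]%classic : set (Leb R)) = set0.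
    rewrite -subset0 => y []; rewrite /upper_half/= !in_itv/= =>
      /andP[y2 _] /andP[_ yx].
    by have := lt_le_trans y2 (le_trans yx xle); rewrite ltxx.
  by rewrite measure0/= mulr0.
have -> : upper_half `&` (`[0, x]%classic : set (Leb R)) = `]2^-1, x]%classic.
  apply/seteqP; split=> y; rewrite /upper_half/= !in_itv/=.
    by move=> [/andP[-> _] /andP[]].
  move=> /andP[y2 yx]; rewrite y2 yx (le_trans yx x1) andbT; split=> //.
  by rewrite (le_trans _ (ltW y2)).
by rewrite lambda_itv_oc ?(ltW xgt)//= mulrC ler_pdivrMr//; lra.
Qed.

Lemma lambda_half_swap :
  lambda (@upper_half) = lambda (@lower_half).
Proof.
rewrite !lambda_itv_oc ?invf_le1 ?ler1n//; congr (_%:E); lra.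
Qed.

End cesaro_halves.

Section ri_halves.
Context {R : realType} (X : fspace R).
Hypothesis hX : ri_space X.

Let bX : banach_function_space X. Proof. by case: hX. Qed.
Let sX : seminormed X := bfs_seminormed bX.

Lemma ri_upper S : measurable S -> S `<=` upper_half ->
  sp_norm X (cesaro_measure S) <= 2 * fine (lambda S) * sp_norm X (cst 1).
Proof.
move=> mS SU; apply: (ri_bounded hX _ _ _).2.
- by rewrite mulr_ge0// fine_ge0.
- by apply: measurable_cesaro_measure => //; exact: measurable_I01.
- by move=> x Ix; rewrite ger0_norm ?cesaro_measure_ge0// cesaro_measure_upper.
Qed.

Lemma ri_upper_half :
  sp_norm X (cesaro_measure upper_half) <= 2^-1 * sp_norm X (cst 1).
Proof.
have mU := @measurable_upper_half R.
apply: (ri_bounded hX _ _ _).2; first by rewrite invr_ge0.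
- by apply: measurable_cesaro_measure => //; exact: measurable_I01.
- by move=> x Ix; rewrite ger0_norm ?cesaro_measure_ge0// cesaro_measure_upper_half.
Qed.

(* [C 1_]0,1/2] >= 1_]0,1/2] + (1/2) 1_]1/2,1]]; adding to the right-hand side
   its mirror image, which is equimeasurable with it, gives the constant 3/2. *)
Lemma ri_lower_half :
  3 / 4 * sp_norm X (cst 1) <= sp_norm X (cesaro_measure lower_half).
Proof.
have mU := @measurable_upper_half R; have mL := @measurable_lower_half R.
have [_ _ n0 nZ nD] := sX.
pose h : Leb R -> R := \1_lower_half + 2^-1 *: \1_upper_half.
pose k : Leb R -> R := \1_upper_half + 2^-1 *: \1_lower_half.
have Xindic S : measurable S -> X \1_S by exact: ri_indic.
have Xh : X h.
  by apply: seminormedD => //; [exact: Xindic|apply: seminormedZ => //;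
    exact: Xindic].
have Xk : X k.
  by apply: seminormedD => //; [exact: Xindic|apply: seminormedZ => //;
    exact: Xindic].
have LU x : lower_half x -> upper_half x -> False.
  rewrite /lower_half /upper_half/= !in_itv/= => /andP[_ xle] /andP[xgt _].
  by have := lt_le_trans xgt xle; rewrite ltxx.
have inLU (x : R) : 0 < x <= 1 -> lower_half x /\ x <= 2^-1 \/ upper_half x
  /\ 2^-1 < x.
  rewrite /lower_half /upper_half/= !in_itv/= => /andP[-> ->].
  by have [|] := leP x 2^-1; [left|right].
have hL x : lower_half x -> h x = 1 /\ k x = 2^-1.
  move=> Lx; have nUx : ~ upper_half x by move=> Ux; exact: LU Ux.
  by rewrite /h /k !fctE !indicE (mem_set Lx) (memNset nUx) /GRing.scale/=
    !mulr0 !mulr1 addr0 add0r.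
have hU x : upper_half x -> h x = 2^-1 /\ k x = 1.
  move=> Ux; have nLx : ~ lower_half x by move=> Lx; exact: LU Ux.
  by rewrite /h /k !fctE !indicE (mem_set Ux) (memNset nLx) /GRing.scale/=
    !mulr0 !mulr1 addr0 add0r.
have kh : sp_norm X k <= sp_norm X h.
  apply: (ri_distribution hX Xh _ _).2; first exact: (bfs_measurable bX).
  move=> tau tau0; rewrite /Defs.distribution.
  have mI := @measurable_I01 R.
  have mh := measurable_levelset tau (bfs_measurable bX Xh).
  have mk := measurable_levelset tau (bfs_measurable bX Xk).
  (* The point 0 belongs to [I01] but to neither half; [k] vanishes there, so no level set of [k]
     contains it. *)
  have kLU x : I01 x -> tau < `|k x| -> lower_half x \/ upper_half x.
    rewrite /I01/= in_itv/= => /andP[]; rewrite le_eqVlt => /predU1P[<- _|x0 x1 _].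
      have nL : ~ lower_half (0 : Leb R) by rewrite /lower_half/= in_itv/= ltxx.
      have nU : ~ upper_half (0 : Leb R).
        by rewrite /upper_half/= in_itv/= => /andP[+ _];
          rewrite ltNge invr_ge0 ler0n.
      rewrite /k !fctE !indicE (memNset nL) (memNset nU).
      by rewrite /GRing.scale/= mulr0 addr0 normr0 ltNge tau0.
    have x01 : 0 < (x : R) <= 1 by rewrite x0 x1.
    by have [[]|[]] := inLU _ x01; [left|right].
  (* For [tau] in [1/2, 1[ the level sets of [h] and [k] are the lower and the upper half, of equal
     measure; for all other [tau] the two level sets agree. *)
  have [tau2|tau2] := ltP tau 2^-1.
    apply: lambda_le => // x [Ix kx]; split=> //=.
    have [Lx|Ux] := kLU _ Ix kx; last by rewrite (hU _ Ux).1 ger0_norm ?invr_ge0.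
    by rewrite (hL _ Lx).1 normr1 (lt_trans tau2)// invf_lt1// ltr1n.
  have [tau1|tau1] := ltP tau 1.
    apply: (@le_trans _ _ (lambda (@upper_half R))).
      apply: lambda_le => // x [Ix kx]; have [Lx|//] := kLU _ Ix kx.
      by move: kx; rewrite /= (hL _ Lx).2 ger0_norm ?invr_ge0// ltNge tau2.
    rewrite lambda_half_swap; apply: lambda_le => // x Lx; split=> /=.
      move: Lx; rewrite /lower_half /I01/= !in_itv/= => /andP[x0 xle].
      by rewrite (ltW x0) (le_trans xle)// invf_le1// ler1n.
    by rewrite (hL _ Lx).1 normr1.
  rewrite [X in lambda X](_ : _ = set0) ?measure0// -subset0 => x [Ix kx].
  have [Lx|Ux] := kLU _ Ix kx; move: kx => /=.
    by rewrite (hL _ Lx).2 ger0_norm ?invr_ge0// ltNge tau2.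
  by rewrite (hU _ Ux).2 normr1 ltNge tau1.
have hC : sp_norm X h <= sp_norm X (cesaro_measure lower_half).
  apply: (bfs_ideal_pos hX (ri_cesaro_measure hX mL) _ _).2.
    exact: (bfs_measurable bX).
  move=> x Ix; have [C1 C2] := cesaro_measure_lower_half Ix.
  rewrite (ger0_norm (cesaro_measure_ge0 _ mL)).
  have [[Lx xle]|[Ux xgt]] := inLU _ Ix.
    by rewrite (hL _ Lx).1 normr1 C1.
  by rewrite (hU _ Ux).1 ger0_norm ?invr_ge0.
have hk : 3 / 2 * sp_norm X (cst 1) <= sp_norm X (h + k).
  rewrite -[3 / 2]ger0_norm// -nZ; last exact: ri_one.
  apply: (bfs_ideal_pos hX (seminormedD sX Xh Xk) _ _).2.
    by apply: (bfs_measurable bX); apply: seminormedZ => //; exact: ri_one.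
  move=> x Ix; rewrite !fctE.
  have [[Lx xle]|[Ux xgt]] := inLU _ Ix.
    by rewrite (hL _ Lx).1 (hL _ Lx).2 /GRing.scale/= mulr1;
      rewrite !ger0_norm//; lra.
  by rewrite (hU _ Ux).1 (hU _ Ux).2 /GRing.scale/= mulr1;
    rewrite !ger0_norm//; lra.
(* With |.| the norm: 3/2 |1| <= |h + k| <= |h| + |k| <= 2 |h| <= 2 |C 1_]0,1/2]|. *)
have := nD _ _ Xh Xk; lra.
Qed.

End ri_halves.

(** * The Cesaro space *)

Section cesaro_space_not_ri_not_reflexive.
Context {R : realType} (X : fspace R).
Hypothesis hX : ri_space X.
Implicit Types (f g : Leb R -> R) (S : set (Leb R)).

Let bX : banach_function_space X. Proof. by case: hX. Qed.
Let sX : seminormed X := bfs_seminormed bX.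

(** The two halves are equimeasurable, so invariance would give 3/4 |1| <= 1/2 |1| in [X]. The last
    hypothesis is conditional because invariance itself yields that the lower indicator belongs to
    [Y]. *)
Lemma not_ri_halves (Y : fspace R) : Y \1_upper_half ->
  sp_norm Y \1_upper_half <= sp_norm X (cesaro_measure upper_half) ->
  (Y \1_lower_half ->
    sp_norm X (cesaro_measure lower_half) <= sp_norm Y \1_lower_half) ->
  ~ rearrangement_invariant Y.
Proof.
have mU := @measurable_upper_half R; have mL := @measurable_lower_half R.
move=> YU nU nL ri.
have UI : I01 `&` upper_half = @upper_half R.
  apply: setIidr => x; rewrite /I01 /upper_half/= !in_itv/= => /andP[x2 ->].
  by rewrite andbT (le_trans _ (ltW x2)) ?invr_ge0.
have LI : I01 `&` lower_half = @lower_half R.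
  apply: setIidr => x; rewrite /I01 /lower_half/= !in_itv/= => /andP[/ltW -> x2]/=.
  by rewrite (le_trans x2)// invf_le1// ler1n.
have [|YL nLU] := ri _ _ YU (measurable_indic_I01 mL).
  move=> t _; apply: le_ereal_inf => _ [tau [tau0 h] <-]; exists tau => //;
    split=> //.
  move: h; rewrite !distribution_indic// UI LI lambda_half_swap.
  by [].
have := nL YL; have := ri_upper_half hX; have := ri_lower_half hX.
have := ri_one_gt0 hX; lra.
Qed.

Lemma cesaro_space_scaled_indic (c : R) S : 0 <= c -> measurable S ->
  cesaro_space X (c *: \1_S) /\
  sp_norm (cesaro_space X) (c *: \1_S) = c * sp_norm X (cesaro_measure S).
Proof.
move=> c0 mS; have [_ _ _ nZ _] := sX.
have CE : Defs.cesaro (fun x => `|((c *: \1_S) : Leb R ->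
  R) x|) = c *: cesaro_measure S :> (Leb R -> R).
  by apply/funext => x; exact: cesaroZ_indic.
have mcS D : measurable_fun D (c *: \1_S : Leb R -> R).
  by apply: measurable_funM => //; exact: measurable_indic.
have XC := ri_cesaro_measure hX mS.
split; last by rewrite /= CE nZ// ger0_norm.
split; [exact: mcS| |by rewrite CE; exact: seminormedZ].
apply: aeW => x Ix; have mi := measurable_itvL `[0, x : R].
have ii : lambda.-integrable (`[0%R, x : R]%classic : set (Leb R)) (EFin \o \1_S).
  apply: integrable_indic_lambda => //.
  rewrite lambda_itv_cc ?ltry//.
  by move: Ix; rewrite /I01/= in_itv/= => /andP[].
exact: (integrableZl mi c ii).
Qed.

Lemma cesaro_space_indic S : measurable S ->
  cesaro_space X \1_S /\ sp_norm (cesaro_space X) \1_S = sp_norm X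
    (cesaro_measure S).
Proof.
move=> mS; have := cesaro_space_scaled_indic ler01 mS.
by rewrite scale1r mul1r.
Qed.

Lemma cesaro_space_not_ri : ~ rearrangement_invariant (cesaro_space X).
Proof.
have [YU nU] := cesaro_space_indic (@measurable_upper_half R).
have [YL nL] := cesaro_space_indic (@measurable_lower_half R).
by apply: not_ri_halves => //; rewrite ?nU// nL.
Qed.

Lemma ac_part_cesaro_space_not_ri :
  ~ rearrangement_invariant (ac_part (cesaro_space X)).
Proof.
have mU := @measurable_upper_half R.
have [YU nU] := cesaro_space_indic mU.
have [YL nL] := cesaro_space_indic (@measurable_lower_half R).
apply: not_ri_halves.
- split=> // e e0; have N0 := ri_one_gt0 hX.
  (* By [ri_upper], restricting the indicator to [A] leaves a norm of at most 2 lambda(A) times the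
     norm of 1. *)
  exists (e / (2 * sp_norm X (cst 1))); first by rewrite divr_gt0// mulr_gt0.
  move=> A mA AI Ad; have mUA := measurableI _ _ mU mA.
  have -> : (fun x => \1_upper_half x * \1_A x) = \1_(upper_half `&` A) :> (Leb
    R -> R).
    by rewrite indicI.
  rewrite (cesaro_space_indic mUA).2.
  apply: le_lt_trans (ri_upper hX mUA (@subIsetl _ _ _)) _.
  have Afin : lambda A \is a fin_num by rewrite ge0_fin_numE// (lt_trans Ad)// ltry.
  have : fine (lambda (upper_half `&` A)) <= fine (lambda A).
    rewrite fine_le//; last by apply: lambda_le => //; exact: subIsetr.
    rewrite ge0_fin_numE//; apply: le_lt_trans (lambda_le mUA mA (@subIsetr _ _
      _)) _.
    by rewrite -ge0_fin_numE.
  move: Ad; rewrite -(fineK Afin) lte_fin ltr_pdivlMr ?mulr_gt0//= => Ad UA.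
  by apply: le_lt_trans Ad; rewrite mulrCA mulrA ler_pM2r// ler_pM2l.
- by rewrite -[leLHS]/(sp_norm (cesaro_space X) _) nU.
- by rewrite -[leRHS]/(sp_norm (cesaro_space X) _) nL.
Qed.

Definition last_quarter : set (Leb R) := `]3 / 4, 1]%classic.

(** For x in ]3/4, 1] the interval [0, x] contains [Jhalf] and 1/x >= 1. Thus C|f| dominates, almost
    everywhere, the integral over [Jhalf] times the indicator of [last_quarter]. *)
Lemma cesaro_space_integral f : cesaro_space X f ->
  (\int[lambda]_(x in Jhalf) `|f x|%:E <=
    ((sp_norm X \1_last_quarter)^-1 * sp_norm (cesaro_space X) f)%:E)%E.
Proof.
move=> [mf [N [mN N0 intf]] XC].
have mQ : measurable last_quarter by exact: measurable_itvL.
have mJ : measurable (@Jhalf R) by exact: measurable_itvL.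
have QI : last_quarter `<=` I01.
  by move=> x; rewrite /last_quarter /I01/= !in_itv/= => /andP[? ?];
    apply/andP; split; lra.
have lQ : (0 < lambda last_quarter)%E.
  by rewrite lambda_itv_oc ?lte_fin; lra.
have nQ := ri_norm_indic_gt0 hX mQ QI lQ.
have JC (x : R) : last_quarter x -> ~ N x ->
    (\int[lambda]_(x in Jhalf) `|f x|%:E <= (Defs.cesaro (fun x => `|f x|) x)%:E)%E.
  move=> Qx Nx; have ifx : lambda.-integrable (`[0,
    x]%classic : set (Leb R)) (EFin \o f).
    by apply: contrapT => nif; apply: Nx; apply: intf => /= /(_ (QI _ Qx)).
  move: Qx; rewrite /last_quarter/= in_itv/= => /andP[x34 x1].
  have mi := measurable_itvL `[0, x].
  have ifn : (\int[lambda]_(y in (`[0%R, x]%classic : set (Leb R))) `|f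
    y|%:E)%E \is a fin_num.
    by have /integrable_fin_num := integrable_norm ifx; apply.
  rewrite /Defs.cesaro EFinM /Rintegral fineK//.
  apply: (@le_trans _ _ (\int[lambda]_(y in (`[0%R,
    x]%classic : set (Leb R))) `|f y|%:E)%E).
    apply: ge0_subset_integral => //.
      apply/measurable_EFinP/measurableT_comp => //.
      by apply/measurable_EFinP; exact: (measurable_int _ ifx).
    move=> y; rewrite /Jhalf/= !in_itv/= => /andP[y2 y34].
    by apply/andP; split; lra.
  rewrite -[leLHS]mul1e lee_wpmul2r ?integral_ge0// lee_fin invf_ge1//; lra.
set I := (X in (X <= _)%E).
have I0 : (0 <= I)%E by exact: integral_ge0.
have Ifin : I \is a fin_num.
  (* A single point off the exceptional null set shows that the integral is finite; only then can
     [fine I] serve as a scalar. *)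
  have [x [Qx Nx]] : exists x, last_quarter x /\ ~ N x.
    apply: contrapT => h; have QN : last_quarter `<=` N.
      by move=> x Qx; apply: contrapT => Nx; apply: h; exists x.
    by have := lambda_le mQ mN QN; rewrite N0 leNgt lQ.
  by rewrite ge0_fin_numE// (le_lt_trans (JC _ Qx Nx))// ltry.
rewrite -(fineK Ifin) lee_fin ler_pdivlMl// mulrC.
have [_ _ [_ _ nZ _] ideal _] := bX.
rewrite -[fine I]ger0_norm ?fine_ge0// -nZ; last exact: ri_indic.
apply: (ideal _ _ XC _ _).2.
  apply: (bfs_measurable bX); apply: seminormedZ => //; exact: ri_indic.
exists N; split=> // x /= /not_implyP[Ix h]; apply: contrapT => Nx; apply: h.
rewrite -[(_ *: _) x]/(fine I * \1_last_quarter x) indicE.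
have [Qx|nQx] := pselect (last_quarter x); last first.
  by rewrite memNset// mulr0 normr0.
rewrite mem_set// mulr1 ger0_norm ?fine_ge0// (le_trans _ (ler_norm _))//.
by rewrite -lee_fin fineK//; exact: JC.
Qed.

Lemma Jhalf_upper_half : @Jhalf R `<=` upper_half.
Proof.
move=> x; rewrite /Jhalf /upper_half/= !in_itv/= => /andP[-> h]/=; lra.
Qed.

Lemma cesaro_space_not_reflexive : ~ reflexive_space (cesaro_space X).
Proof.
have [_ _ n0 _ _] := sX.
apply: (@not_reflexive_escaping_mass _ _ _ (2 * sp_norm X (cst 1))
    (sp_norm X \1_last_quarter)^-1).
- by move=> f [_ _ XC]; exact: n0.
- by rewrite mulr_gt0// ri_one_gt0.
- move=> c S c0 mS SJ; have [YS nS] := cesaro_space_scaled_indic (ltW c0) mS.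
  split=> //; rewrite nS ler_pM2l//.
  rewrite mulrAC; apply: ri_upper => //.
  exact: subset_trans SJ Jhalf_upper_half.
- by move=> f [].
- exact: cesaro_space_integral.
Qed.

End cesaro_space_not_ri_not_reflexive.

(** * The space [L^1(m)] *)

Section variation_cesaro_measure.
Context {R : realType} (X : fspace R).
Hypothesis hX : ri_space X.
Implicit Types (f g : Leb R -> R) (A B S : set (Leb R)) (phi : (Leb R -> R) -> R).

Let bX : banach_function_space X. Proof. by case: hX. Qed.
Let sX : seminormed X := bfs_seminormed bX.
Let X0 : X 0. Proof. by case: sX. Qed.

Local Notation m := (@cesaro_measure R).

Lemma cesaro_measure0 : m set0 = 0.
Proof. by apply/funext => x; rewrite cesaro_measureE// set0I measure0/= mulr0. Qed.

Lemma dual_cesaro_measure0 phi : linear_on X phi -> phi (m set0) = 0.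
Proof. by rewrite cesaro_measure0; exact: linear_on0. Qed.

Lemma dual_cesaro_measureD phi A B : linear_on X phi -> measurable A ->
  measurable B ->
  A `&` B = set0 -> phi (m (A `|` B)) = phi (m A) + phi (m B).
Proof.
move=> lphi mA mB AB; rewrite [m (A `|` B)](cesaro_measureD mA mB AB).
by rewrite (linear_onD lphi)//; exact: ri_cesaro_measure.
Qed.

Lemma variation0 (nu : set (Leb R) -> R) : nu set0 = 0 ->
  Defs.variation nu set0 = 0%E.
Proof.
move=> nu0; rewrite /Defs.variation; apply/eqP; rewrite eq_le; apply/andP; split.
  apply: ge_ereal_sup => _ [n [F [mF tF UF ->]]]; rewrite lee_fin big1// => i _.
  suff -> : F i = set0 by rewrite nu0 normr0.
  by apply/seteqP; split=> // x Fx; rewrite -UF -bigcup_mkord; exists i => /=.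
apply: ereal_sup_ubound; exists 0%N, (fun=> set0); split=> //.
- by rewrite big_ord0.
- by rewrite big_ord0.
Qed.

Lemma variation_ge (nu : set (Leb R) -> R) A : measurable A ->
  (`|nu A|%:E <= Defs.variation nu A)%E.
Proof.
move=> mA; apply: ereal_sup_ubound; exists 1%N, (fun=> A); split=> //.
- by move=> i j /= ; rewrite !ltnS !leqn0 => /eqP-> /eqP->.
- by rewrite big_ord1.
- by rewrite big_ord1.
Qed.

Lemma variation_ge0 (nu : set (Leb R) -> R) A : measurable A ->
  (0 <= Defs.variation nu A)%E.
Proof. by move=> mA; apply: le_trans (variation_ge nu mA); rewrite lee_fin. Qed.

Lemma trivIset_setU_ord n k (F : nat -> set (Leb R)) : trivIset `I_n F ->
  (k < n)%N -> \big[setU/set0]_(i < k) F i `&` F k = set0.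
Proof.
move=> tF kn; rewrite -subset0 -bigcup_mkord => x [[j /= jk Fjx] Fkx].
have jE : j = k.
  by apply: tF => //=; [exact: ltn_trans kn|exists x].
by rewrite jE ltnn in jk.
Qed.

(** With the signs s_i of phi(m(F_i)), the sum of the absolute values is [phi] of the sum of s_i
    m(F_i). Since Cesaro means of indicators are nonnegative, that function is bounded pointwise by
    m(A), and the ideal property of [X] applies. *)
Lemma variation_le phi K A : linear_on X phi ->
  (forall f, X f -> `|phi f| <= K * sp_norm X f) -> 0 <= K -> measurable A ->
  (Defs.variation (phi \o m) A <= (K * sp_norm X (m A))%:E)%E.
Proof.
move=> lphi phiK K0 mA; apply: ge_ereal_sup => _ [n [F [mF tF UF ->]]].
rewrite lee_fin.
pose s i : R := Num.sg (phi (m (F i))).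
pose g k : Leb R -> R := \sum_(i < k) s i *: m (F i).
have XF i : X (m (F i)) by exact: ri_cesaro_measure.
have mU k : measurable (\big[setU/set0]_(i < k) F i) by exact: bigsetU_measurable.
have hg k : X (g k) /\ phi (g k) = \sum_(i < k) `|phi (m (F i))|.
  elim: k => [|k [IHX IH]]; first by rewrite /g !big_ord0 (linear_on0 X0 lphi).
  rewrite /g !big_ord_recr/=; have XsF : X (s k *: m (F k)) by exact: seminormedZ.
  split; first exact: seminormedD.
  by rewrite (linear_onD lphi)// [phi (\sum_(_ < _) _)]IH (linear_onZ _ X0
    lphi)// normrEsg.
have gle k x : (k <= n)%N -> `|g k x| <= m (\big[setU/set0]_(i < k) F i) x.
  elim: k => [_|k IH kn].
    by rewrite /g !big_ord0 -[X in `|X|]/(0 : R) normr0 cesaro_measure_ge0.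
  rewrite /g !big_ord_recr/= [m (_ `|` _)](cesaro_measureD (mU k) (mF k)
    (trivIset_setU_ord tF kn)).
  rewrite !fctE (le_trans (ler_normD _ _))// lerD ?IH ?(ltnW kn)//.
  rewrite -[s k *: m (F k) x]/(s k * m (F k) x) normrM (ger0_norm
    (cesaro_measure_ge0 _ (mF k))).
  by rewrite ler_piMl ?cesaro_measure_ge0// /s normr_sg; case: eqP.
rewrite -[leLHS](hg n).2 (le_trans (ler_norm _))// (le_trans (phiK _ (hg n).1))//.
rewrite ler_wpM2l//; apply: (bfs_ideal bX (ri_cesaro_measure hX mA) _ _).2.
  exact: (bfs_measurable bX (hg n).1).
move=> x _; rewrite (ger0_norm (cesaro_measure_ge0 _ mA)).
by rewrite -UF; exact: gle.
Qed.

(** A partition of [A] followed by one of [B] is a partition of the union. Finiteness permits taking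
    the two suprema one after the other by subtraction. *)
Lemma variation_superadditive (nu : set (Leb R) -> R) :
  (forall A, measurable A -> (Defs.variation nu A < +oo)%E) ->
    superadditive (Defs.variation nu).
Proof.
move=> nufin A B mA mB AB.
have Afin : Defs.variation nu A \is a fin_num by rewrite ge0_fin_numE
  ?variation_ge0// nufin.
have Bfin : Defs.variation nu B \is a fin_num by rewrite ge0_fin_numE
  ?variation_ge0// nufin.
rewrite -leeBrDr//; apply: ge_ereal_sup => _ [n [F [mF tF UF ->]]].
rewrite leeBrDr// addeC -leeBrDr//; apply: ge_ereal_sup => _ [k [G [mG tG UG ->]]].
rewrite leeBrDr// addeC; apply: ereal_sup_ubound.
pose H i := if (i < n)%N then F i else G (i - n)%N.
have HF i : (i < n)%N -> H i = F i by rewrite /H => ->.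
have HG i : H (n + i)%N = G i by rewrite /H ltnNge leq_addr/= addKn.
exists (n + k)%N, H; split.
- by move=> i; rewrite /H; case: ifP.
- move=> i j /= ink jnk [x [Hi Hj]].
  have UFx i' : (i' < n)%N -> F i' x -> A x.
    by move=> i'n Fx; rewrite -UF -bigcup_mkord; exists i'.
  have UGx i' : (i' < n + k)%N -> (n <= i')%N -> G (i' - n)%N x -> B x.
    by move=> i'n ni' Gx; rewrite -UG -bigcup_mkord; exists (i' - n)%N => //=;
      rewrite ltn_subLR.
  have AB0 : A x -> B x -> False by move=> Ax Bx; have : (A `&` B) x by [];
    rewrite AB.
  move: Hi Hj; rewrite /H; case: (ltnP i n) => ni; case: (ltnP j n) => nj Hi Hj.
  + by apply: tF => //; exists x.
  + by exfalso; apply: AB0; [exact: UFx Hi|exact: UGx Hj].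
  + by exfalso; apply: AB0; [exact: UFx Hj|exact: UGx Hi].
  + have : (i - n)%N = (j - n)%N by apply: tG => /=; rewrite ?ltn_subLR//; exists x.
    by move=> ijn; rewrite -(subnK ni) ijn subnK.
- rewrite big_split_ord/=; congr (_ `|` _).
    by rewrite -UF; apply: eq_bigr => i _; rewrite HF.
  by rewrite -UG; apply: eq_bigr => i _; rewrite HG.
- rewrite -EFinD big_split_ord/=; congr (_ + _)%:E.
    by apply: eq_bigr => i _; rewrite HF.
  by apply: eq_bigr => i _; rewrite HG.
Qed.

End variation_cesaro_measure.

Section L1_cesaro_measure.
Context {R : realType} (X : fspace R).
Hypothesis hX : ri_space X.
Implicit Types (f g : Leb R -> R) (A B S : set (Leb R)) (phi : (Leb R -> R) -> R).

Let bX : banach_function_space X. Proof. by case: hX. Qed.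
Let sX : seminormed X := bfs_seminormed bX.
Let X0 : X 0. Proof. by case: sX. Qed.
Let norm_ge0 f : X f -> 0 <= sp_norm X f. Proof. by case: sX => _ _ + _ _;
  exact. Qed.

Local Notation m := (@cesaro_measure R).
Local Notation var phi := (Defs.variation (phi \o m)).

Section one_functional.
Variable phi : (Leb R -> R) -> R.
Hypothesis dphi : dual X phi.

Let lphi : linear_on X phi. Proof. by case: dphi. Qed.

Lemma dual_variation_lty A : measurable A -> (var phi A < +oo)%E.
Proof.
move=> mA; have [_ [K hK]] := dphi.
apply: le_lt_trans (variation_le hX (K := `|K|) lphi _ _ mA) _ => //;
  last by rewrite ltry.
move=> f Xf; apply: le_trans (hK _ Xf) _.
by rewrite ler_wpM2r ?norm_ge0// ler_norm.
Qed.

Let var0 : var phi set0 = 0%E.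
Proof. by apply: variation0; exact: (dual_cesaro_measure0 hX lphi). Qed.

Let var_ge0 A : measurable A -> (0 <= var phi A)%E.
Proof. exact: variation_ge0. Qed.

Let var_super : superadditive (var phi).
Proof. by apply: variation_superadditive; exact: dual_variation_lty. Qed.

Let varfin A : measurable A -> var phi A \is a fin_num.
Proof. by move=> mA; rewrite ge0_fin_numE ?var_ge0// dual_variation_lty. Qed.

Lemma integral_variation_indic (c : R) S : 0 < c -> measurable S ->
  (\int[var phi]_(x in I01) `|(c *: (\1_S : Leb R -> R)) x|%:E =
   c%:E * var phi (S `&` I01))%E.
Proof.
move=> c0 mS; rewrite -integral_scaled_indic//; last exact: measurable_I01.
congr integral; apply/funext => x; congr (_%:E).
by rewrite ger0_norm// mulr_ge0// ltW.
Qed.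

(** The values 1 and -1 of [e] give the two Jordan parts used in [signed_integral]. *)
Let jordan (e : R) B : \bar R := ((2^-1)%:E * (var phi B + (e * phi (m B))%:E))%E.

Let jordan_sum_ge0 e B : `|e| = 1 -> measurable B ->
  (0 <= var phi B + (e * phi (m B))%:E)%E.
Proof.
move=> e1 mB; rewrite -leeBlDr// sub0e -EFinN; apply: le_trans (variation_ge _ mB).
by rewrite lee_fin -mulNr (le_trans (ler_norm _))// normrM normrN e1 mul1r.
Qed.

Let integral_jordan e (c : R) A S : `|e| = 1 -> 0 < c -> measurable A ->
  measurable S ->
  (\int[jordan e]_(x in A) ((c *: (\1_S : Leb R ->
    R)) x)%:E = c%:E * jordan e (S `&` A))%E.
Proof.
move=> e1 c0 mA mS; apply: integral_scaled_indic => //.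
- by rewrite /jordan var0 (dual_cesaro_measure0 hX lphi) mulr0 adde0 mule0.
- by move=> B mB; rewrite /jordan mule_ge0 ?lee_fin ?invr_ge0// jordan_sum_ge0.
- move=> B D mB mD BD; rewrite /jordan -ge0_muleDr ?jordan_sum_ge0//.
  rewrite lee_wpmul2l ?lee_fin ?invr_ge0//.
  rewrite addeACA -EFinD (dual_cesaro_measureD hX lphi)// -mulrDr leeD2r//.
  exact: var_super.
Qed.

(** In the difference of the two Jordan parts the variations cancel, being finite, and the two
    halves of phi(m) add up. *)
Lemma signed_integral_indic (c : R) A S : 0 < c -> measurable A -> measurable S ->
  signed_integral (phi \o m) A (c *: \1_S) = c * phi (m (S `&` A)).
Proof.
move=> c0 mA mS; have mSA := measurableI _ _ mS mA.
rewrite /signed_integral.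
have -> : (fun B => (2^-1)%:E * (var phi B + ((phi \o m) B)%:E))%E = jordan 1.
  by apply/funext => B; rewrite /jordan mul1r.
have -> : (fun B => (2^-1)%:E * (var phi B - ((phi \o m) B)%:E))%E = jordan (-1).
  by apply/funext => B; rewrite /jordan mulN1r EFinN.
rewrite !integral_jordan ?normr1 ?normrN1// /jordan.
rewrite -(fineK (varfin mSA)) /=; by field.
Qed.

End one_functional.

Let L1 := L1_vm X m.

Lemma L1_vm_indic (c : R) S : 0 < c -> measurable S -> L1 (c *: \1_S).
Proof.
move=> c0 mS.
have mcS D : measurable_fun D (c *: \1_S : Leb R -> R).
  by apply: measurable_funM => //; exact: measurable_indic.
split; first exact: mcS.
- move=> phi dphi; apply/integrableP; split; first exact/measurable_EFinP/mcS.
  have mSI := measurableI _ _ mS (@measurable_I01 R).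
  rewrite [ltLHS](integral_variation_indic dphi c0 mS).
  rewrite lte_mul_pinfty ?lee_fin ?(ltW c0)//.
  exact: dual_variation_lty.
- move=> A mA AI; have mSA := measurableI _ _ mS mA.
  (* The vector integral of a scaled indicator is the scaled value of the measure. *)
  exists (c *: m (S `&` A)).
    by apply: seminormedZ => //; exact: ri_cesaro_measure.
  move=> phi dphi; rewrite (signed_integral_indic dphi c0 mA mS).
  by rewrite (linear_onZ _ X0 dphi.1)//; exact: ri_cesaro_measure.
Qed.

Let balls f : set (\bar R) :=
  [set (\int[var phi]_(x in I01) `|f x|%:E)%E |
    phi in [set phi | dual X phi /\ sp_norm (dual X) phi <= 1]].

Let L1normE f : sp_norm L1 f = fine (ereal_sup (balls f)).
Proof. by []. Qed.

Let dual0 : dual X (fun=> 0).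
Proof.
split; first by move=> a f g _ _; rewrite mulr0 addr0.
by exists 0 => f _; rewrite normr0 mul0r.
Qed.

Let dual0_norm : sp_norm (dual X) (fun=> 0) <= 1.
Proof.
apply: dual_norm_le => //; first exact: seminormed0.
by move=> f _ _; rewrite normr0.
Qed.

Lemma integral_variation_ge0 phi f :
  dual X phi -> (0 <= \int[var phi]_(x in I01) `|f x|%:E)%E.
Proof.
move=> dphi; apply: integral_set_function_ge0 => //.
- by apply: variation0; exact: (dual_cesaro_measure0 hX dphi.1).
- by move=> A; exact: variation_ge0.
Qed.

Let balls_ge0 f : (0 <= ereal_sup (balls f))%E.
Proof.
apply: le_trans (integral_variation_ge0 f dual0) _.
by apply: ereal_sup_ubound; exists (fun=> 0).
Qed.

Lemma L1_vm_norm_ge0 f : 0 <= sp_norm L1 f.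
Proof. by rewrite L1normE fine_ge0. Qed.

(** Functionals of the unit ball satisfy [variation_le] with K = 1. The bound is on the supremum
    itself, so that it also shows its finiteness before [fine] is taken. *)
Lemma L1_vm_norm_indic_le (c : R) S : 0 < c -> measurable S ->
  (ereal_sup (balls (c *: \1_S)) <= (c * sp_norm X (m S))%:E)%E.
Proof.
move=> c0 mS; have mSI := measurableI _ _ mS (@measurable_I01 R).
apply: ge_ereal_sup => _ [phi [dphi phi1] <-].
rewrite integral_variation_indic// EFinM lee_wpmul2l ?lee_fin ?(ltW c0)//.
have phin f : X f -> `|phi f| <= 1 * sp_norm X f.
  by move=> Xf; rewrite mul1r; exact: (dual_ball sX dphi phi1).
apply: le_trans (variation_le hX dphi.1 phin ler01 mSI) _.
rewrite lee_fin mul1r; apply: (bfs_ideal bX (ri_cesaro_measure hX mS) _ _).2.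
  by apply: (bfs_measurable bX); exact: ri_cesaro_measure.
move=> x _; rewrite !ger0_norm ?cesaro_measure_ge0//.
by apply: cesaro_measure_le => //; exact: subIsetl.
Qed.

Lemma L1_vm_norm_scaled_indic_le (c : R) S : 0 < c -> measurable S ->
  sp_norm L1 (c *: \1_S) <= c * sp_norm X (m S).
Proof.
move=> c0 mS; have := L1_vm_norm_indic_le c0 mS; rewrite L1normE => h.
rewrite -lee_fin fineK; first exact: h.
by rewrite ge0_fin_numE// (le_lt_trans h)// ltry.
Qed.

(** A functional of the unit ball that norms m(S) has a variation on [S] at least equal to that
    norm. *)
Lemma L1_vm_norm_indic_ge S : measurable S -> S `<=` I01 ->
  sp_norm X (m S) <= sp_norm L1 \1_S.
Proof.
move=> mS SI; have [phi [dphi phi1 phiS]] := hahn_banach sX (ri_cesaro_measure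
  hX mS).
have h1 := L1_vm_norm_indic_le ltr01 mS; rewrite scale1r in h1.
rewrite -phiS L1normE -lee_fin fineK; last first.
  by rewrite ge0_fin_numE// (le_lt_trans h1)// ltry.
apply: le_trans (_ : (\int[var phi]_(x in I01) `|\1_S x|%:E <= _)%E); last first.
  by apply: ereal_sup_ubound; exists phi.
have := integral_variation_indic dphi ltr01 mS; rewrite scale1r mul1e => ->.
rewrite (setIidl SI); apply: le_trans (variation_ge _ mS).
by rewrite lee_fin ler_norm.
Qed.

Lemma L1_vm_not_ri : ~ rearrangement_invariant L1.
Proof.
have mU := @measurable_upper_half R; have mL := @measurable_lower_half R.
have YU := L1_vm_indic ltr01 mU; rewrite scale1r in YU.
apply: (not_ri_halves hX) => //.
  by have := L1_vm_norm_scaled_indic_le ltr01 mU; rewrite scale1r mul1r.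
move=> _; apply: L1_vm_norm_indic_ge => // x.
rewrite /I01 /lower_half/= !in_itv/= => /andP[/ltW -> x2]/=.
by rewrite (le_trans x2)// invf_le1// ler1n.
Qed.

(* The norm is a [fine], hence would be 0 if the supremum were infinite. *)
Lemma L1_vm_norm_fin f : L1 f -> ereal_sup (balls f) \is a fin_num.
Proof.
move=> [mf intf _]; rewrite ge0_fin_numE// ltNge leye_eq; apply/negP => /eqP oo.
(* The growth 4^k is chosen to beat the factor 2^(k+1) lost in passing to a common majorant: the
   integral against the variation of [psi] would be at least 2^k / 2 for every k. *)
have /choice[phi hphi] : forall k : nat, exists phi, [/\ dual X phi,
  sp_norm (dual X) phi <= 1 &
    ((4 ^+ k)%:E <= \int[var phi]_(x in I01) `|f x|%:E)%E].
  move=> k; apply: contrapT => h.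
  have : (ereal_sup (balls f) <= (4 ^+ k)%:E)%E.
    apply: ge_ereal_sup => _ [phi [dphi phi1] <-]; rewrite leNgt; apply/negP => k4.
    by apply: h; exists phi; split=> //; exact: ltW.
  by rewrite oo leye_eq.
have dphi k : dual X (phi k) by case: (hphi k).
have phi1 k : sp_norm (dual X) (phi k) <= 1 by case: (hphi k).
have [psi dpsi psi_ge] := positive_majorant bX dphi phi1.
have /integrableP[_ ] := intf _ dpsi.
have var0 chi : dual X chi -> var chi set0 = 0%E.
  by move=> dchi; apply: variation0; exact: (dual_cesaro_measure0 hX dchi.1).
have le_int k : (\int[var (phi k)]_(x in I01) `|f x|%:E <=
    (2 ^+ k.+1)%:E * \int[var psi]_(x in I01) `|f x|%:E)%E.
  apply: ge0_le_integral_set_function => //.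
  - exact: var0.
  - exact: var0.
  - by move=> A; exact: variation_ge0.
  - by move=> A; exact: variation_ge0.
  (* Each |phi k (m(F_i))| is at most 2^(k+1) psi(m(F_i)), because m(F_i) >= 0; these bounds carry
     no absolute values, so they add up to 2^(k+1) psi(m(A)). *)
  move=> A mA _; apply: ge_ereal_sup => _ [n [F [mF tF UF ->]]].
  have mU j : measurable (\big[setU/set0]_(i < j) F i) by exact: bigsetU_measurable.
  have psiU j : (j <= n)%N ->
      psi (m (\big[setU/set0]_(i < j) F i)) = \sum_(i < j) psi (m (F i)).
    elim: j => [_|j IH jn]; first by rewrite !big_ord0 (dual_cesaro_measure0 hX
      dpsi.1).
    rewrite !big_ord_recr/= (dual_cesaro_measureD hX dpsi.1 (mU j) (mF j)).
      by rewrite IH// ltnW.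
    exact: trivIset_setU_ord tF jn.
  apply: (@le_trans _ _ ((2 ^+ k.+1)%:E * (psi (m A))%:E)%E); last first.
    rewrite lee_wpmul2l ?lee_fin// (le_trans _ (variation_ge _ mA))//.
    by rewrite lee_fin ler_norm.
  rewrite -EFinM lee_fin -UF psiU// mulr_sumr; apply: ler_sum => i _.
  have := psi_ge _ (ri_cesaro_measure hX (mF i)) (fun x =>
    cesaro_measure_ge0 x (mF i)) k.
  by rewrite exprVn ler_pdivrMl ?exprn_gt0.
rewrite -[ltLHS]/(\int[var psi]_(x in I01) `|f x|%:E)%E.
set I := (X in (X < _)%E) => Ioo.
have I0 : (0 <= I)%E by exact: integral_variation_ge0.
have Ifin : I \is a fin_num by rewrite ge0_fin_numE.
have h k : 2 ^+ k <= 2 * fine I.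
  have [_ _ hk] := hphi k; have := le_trans hk (le_int k).
  rewrite -[X in (_ <= _ * X)%E]/I -(fineK Ifin) -EFinM lee_fin.
  have -> : 4 = 2 * 2 :> R by rewrite -natrM.
  rewrite exprMn exprS -mulrA mulrCA ler_pM2l ?exprn_gt0//.
have := h (Num.truncn (2 * fine I)).+1.
have := truncnS_gt (2 * fine I); move: (Num.truncn _).+1 => k Ik kI.
suff k2 : k%:R <= 2 ^+ k :> R by have := lt_le_trans Ik (le_trans k2 kI);
  rewrite ltxx.
by rewrite -natrX ler_nat ltnW// ltn_expl.
Qed.

(** The functional [chi] satisfies chi(m(S)) = 4 lambda(S) |u| for S inside [Jhalf], so its
    variation dominates a multiple of lambda there. As [chi] is in the dual unit ball, the L^1 norm
    on [Jhalf] is bounded by a multiple of the norm of [L1]. *)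
Lemma L1_vm_not_reflexive : ~ reflexive_space L1.
Proof.
have mQ : measurable (@last_quarter R) by exact: measurable_itvL.
have mJ : measurable (@Jhalf R) by exact: measurable_itvL.
have QI : @last_quarter R `<=` I01.
  by move=> x; rewrite /last_quarter /I01/= !in_itv/= => /andP[? ?];
    apply/andP; split; lra.
have JI : @Jhalf R `<=` I01.
  by move=> x; rewrite /Jhalf /I01/= !in_itv/= => /andP[? ?]; apply/andP;
    split; lra.
pose cut h : Leb R -> R := fun x => h x * \1_last_quarter x.
have Xcut h : X h -> X (cut h) /\ sp_norm X (cut h) <= sp_norm X h.
  move=> Xh; apply: bfs_ideal => //.
    by apply: measurable_funM; [exact: (bfs_measurable bX Xh)|exact:
      measurable_indic].
  by move=> x _; rewrite normrM ler_piMr// indicE ger0_norm// lern1 leq_b1.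
pose u := cut (m Jhalf).
have Xu : X u by exact: (Xcut _ (ri_cesaro_measure hX mJ)).1.
have capE B x : B `<=` Jhalf -> last_quarter x ->
    B `&` (`[0, x : R]%classic : set (Leb R)) = B.
  move=> BJ Qx; apply: setIidl => y /BJ; move: Qx.
  rewrite /last_quarter /Jhalf/= !in_itv/= => /andP[? ?] /andP[? ?].
  by apply/andP; split; lra.
have lJ : fine (lambda (@Jhalf R)) = 4^-1 by rewrite lambda_itv_oc/=; lra.
(* On ]3/4, 1] the function m(S) is lambda(S)/x; the factor 4 is the inverse of the measure of
   [Jhalf]. *)
have cutm S : measurable S -> S `<=` Jhalf -> cut (m S) = (4 * fine (lambda S))
  *: u.
  move=> mS SJ; apply/funext => x.
  rewrite /u /cut -[RHS]/(4 * fine (lambda S) * (m Jhalf x * \1_last_quarter x)).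
  rewrite mulrA; have [Qx|nQx] := pselect (last_quarter x); last first.
    by rewrite indicE memNset// !mulr0.
  by congr (_ * _); rewrite !cesaro_measureE// !capE// lJ; lra.
(* On ]3/4, 1] the function 4u equals 1/x >= 1, so it dominates the indicator of [last_quarter]. *)
have u0 : 0 < sp_norm X u.
  have lQ : (0 < lambda (@last_quarter R))%E by rewrite lambda_itv_oc ?lte_fin; lra.
  have u4 : sp_norm X (4 *: u) = 4 * sp_norm X u.
    by have [_ _ _ nZ _] := sX; rewrite nZ// ger0_norm.
  have four0 : 0 < 4 :> R by [].
  rewrite -(pmulr_rgt0 _ four0) -u4; apply: lt_le_trans (ri_norm_indic_gt0 hX
    mQ QI lQ) _.
  apply: (bfs_ideal bX (seminormedZ _ sX Xu) _ _).2; first exact: measurable_indic.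
  move=> x _; rewrite -[(_ *: u) x]/(4 * (m Jhalf x * \1_last_quarter x)) indicE.
  have [Qx|nQx] := pselect (last_quarter x); last by rewrite memNset// normr0.
  rewrite mem_set// mulr1 cesaro_measureE// capE// lJ mulrCA divff// mulr1 normr1.
  move: Qx; rewrite /last_quarter/= in_itv/= => /andP[x34 x1].
  have x0 : 0 < (x : R) by lra.
  by rewrite ger0_norm ?invr_ge0 ?(ltW x0)// invf_ge1.
have [phi [dphi phi1 phiu]] := hahn_banach sX Xu.
pose chi h := phi (cut h).
have chile h : X h -> `|chi h| <= sp_norm X h.
  move=> Xh; apply: le_trans (Xcut _ Xh).2.
  exact: (dual_ball sX dphi phi1 (Xcut _ Xh).1).
have dchi : dual X chi.
  split; last by exists 1 => h Xh; rewrite mul1r chile.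
  move=> a h g Xh Xg; rewrite /chi -(dphi.1 a _ _ (Xcut _ Xh).1 (Xcut _ Xg).1).
  congr phi; apply/funext => x; set q : R := \1_last_quarter x.
  rewrite -[LHS]/((a * h x + g x) * q) -[RHS]/(a * (h x * q) + g x * q); ring.
have chi1 : sp_norm (dual X) chi <= 1.
  apply: dual_norm_le => //; first exact: seminormed0.
  by move=> h Xh h1; apply: le_trans (chile _ Xh) h1.
have chim S : measurable S -> S `<=` Jhalf ->
    chi (m S) = 4 * fine (lambda S) * sp_norm X u.
  by move=> mS SJ; rewrite /chi cutm// (linear_onZ _ X0 dphi.1)// phiu.
have var0 : var chi set0 = 0%E by apply: variation0;
  exact: (dual_cesaro_measure0 hX dchi.1).
apply: (@not_reflexive_escaping_mass _ _ _ (2 * sp_norm X (cst 1))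
    (4 * sp_norm X u)^-1).
- by move=> f _; exact: L1_vm_norm_ge0.
- by rewrite mulr_gt0// ri_one_gt0.
- move=> c S c0 mS SJ; split; first exact: L1_vm_indic.
  apply: le_trans (L1_vm_norm_scaled_indic_le c0 mS) _.
  rewrite ler_pM2l// mulrAC; apply: (ri_upper hX) => //.
  exact: subset_trans SJ (@Jhalf_upper_half R).
- by move=> f [].
move=> f L1f.
apply: (@le_trans _ _ (((4 * sp_norm X u)^-1)%:E * \int[var chi]_(x in Jhalf)
  `|f x|%:E)%E).
  apply: ge0_le_integral_set_function => //.
  - by rewrite invr_ge0 mulr_ge0// ltW.
  - by move=> A; exact: variation_ge0.
  move=> A mA AJ.
  have Afin : lambda A \is a fin_num.
    rewrite ge0_fin_numE//; apply: le_lt_trans (lambda_le mA mJ AJ) _.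
    by rewrite lambda_itv_oc ?ltry//; lra.
  apply: (@le_trans _ _ (((4 * sp_norm X u)^-1)%:E * `|chi (m A)|%:E)%E);
    last first.
    rewrite lee_wpmul2l ?lee_fin ?invr_ge0 ?mulr_ge0 ?(ltW u0)//.
    exact: variation_ge.
  rewrite chim// -(fineK Afin) -EFinM lee_fin /= ger0_norm; last first.
    by rewrite !mulr_ge0// ?fine_ge0// ltW.
  rewrite le_eqVlt; apply/orP; left; apply/eqP; field.
  by rewrite gt_eqF.
rewrite EFinM lee_wpmul2l ?lee_fin ?invr_ge0 ?mulr_ge0 ?(ltW u0)//.
apply: le_trans (integral_set_function_subset var0 _ JI _) _ => //.
  by move=> A; exact: variation_ge0.
rewrite L1normE fineK; last exact: L1_vm_norm_fin.
by apply: ereal_sup_ubound; exists chi.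
Qed.

End L1_cesaro_measure.

Theorem theorem3p3 (R : realType) (X : fspace R) (hX : ri_space X)
    (hXLinfty : carrier X <> Linfty) :
  [/\ ~ reflexive_space (L1_vm X cesaro_measure),
      ~ reflexive_space (cesaro_space X),
      ~ rearrangement_invariant (cesaro_space X),
      ~ rearrangement_invariant (L1_vm X cesaro_measure) &
      ~ rearrangement_invariant (ac_part (cesaro_space X))].
Proof.
split.
- exact: L1_vm_not_reflexive.
- exact: cesaro_space_not_reflexive.
- exact: cesaro_space_not_ri.
- exact: L1_vm_not_ri.
- exact: ac_part_cesaro_space_not_ri.
Qed.
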